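(* Let $1<p,q<\infty$ and let $r$ be defined by $1/p+1/q=1/r$ (so $r$ may be less than $1$). Then for all $f,g\in S$, $$\|\pi_{hl}(f,g)\|_{L^{r,\infty}}\lesssim\|f\|_p\|g\|_q,$$ and the same estimate holds with $\pi_{hl}$ replaced by $\pi_{lh}$ or by $\pi_{hh}$. The implied constants depend only on $p,q$ (not on $M$).
   Context: Fix an integer $M>0$. A dyadic interval is an interval $[j2^k,(j+1)2^k]$ with $j,k$ integers, $-M\le k\le M$, contained in $[0,2^M]$. Each dyadic interval $I$ has an associated lacunary tile $P^+(I)=I\times[1/|I|,2/|I|]$; $\mathbf{P}^+$ is the (finite) set of all lacunary tiles, and for $P=P^+(I)$ write $I_P=I$. $[f]_P=\frac1{|I_P|}\int_{I_P}f$. For $P\in\mathbf{P}^+$, $\phi_P=|I_P|^{-1/2}(\chi_{I_P^l}-\chi_{I_P^r})$, with $I_P^l,I_P^r$ the left and right halves of $I_P$; $Wf(P)=\int f\phi_P$. $S$ is the linear span of all $\phi_P$, $P\in\mathbf{P}^+$, and all $\chi_I$, $I$ dyadic. The paraproducts of $f,g\in S$ are $$\pi_{hl}(f,g)=\sum_{P\in\mathbf{P}^+}Wf(P)[g]_P\phi_P,\quad \pi_{lh}(f,g)=\sum_{P\in\mathbf{P}^+}[f]_PWg(P)\phi_P,\quad \pi_{hh}(f,g)=\sum_{P\in\mathbf{P}^+}Wf(P)Wg(P)\frac{\chi_{I_P}}{|I_P|}.$$ The weak $L^r$ quasi-norm is $\|h\|_{L^{r,\infty}}=\sup_{\lambda>0}\lambda\,|\{x:|h(x)|\ge\lambda\}|^{1/r}$.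 *)

(* Defs.v *)
From mathcomp Require Import all_boot all_order all_algebra.
From mathcomp Require Import complex.
From mathcomp Require Import all_classical all_reals all_analysis.
From mathcomp Require Import zify.

Set Implicit Arguments.
Unset Strict Implicit.
Unset Printing Implicit Defensive.

Import Order.TTheory GRing.Theory Num.Theory.
Import numFieldNormedType.Exports.

Local Open Scope classical_set_scope.
Local Open Scope ring_scope.
Local Open Scope complex_scope.

(* Functions are complex valued; the real-valued case is contained in this one
   because R embeds in R[i] and the norms below agree on real functions. *)

Definition cintegral (R : realType) (D : set R) (f : R -> R[i]) : R[i] :=
  Rintegral lebesgue_measure D (fun x => complex.Re (f x))
  +i* Rintegral lebesgue_measure D (fun x => complex.Im (f x)).

Definition Lp_norm (R : realType) (p : R) (f : R -> R[i]) : \bar R :=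
  Lnorm lebesgue_measure p%:E (fun x => (Normc.normc (f x))%:E).

Definition weak_norm (R : realType) (r : R) (h : R -> R[i]) : \bar R :=
  ereal_sup [set (lambda%:E *
      lebesgue_measure [set x | (lambda <= Normc.normc (h x))%R] `^ r^-1)%E
    | lambda in [set lambda : R | 0 < lambda]].

(* The code (k, j) stands for the interval [j 2^k, (j+1) 2^k]. *)
Notation dyadic_code := (int * int)%type.

Definition dlen (R : realType) (I : dyadic_code) : R := 2 ^ I.1.

Definition dleft (R : realType) (I : dyadic_code) : R := I.2%:~R * 2 ^ I.1.

Definition dright (R : realType) (I : dyadic_code) : R :=
  (I.2 + 1)%:~R * 2 ^ I.1.

Definition dmid (R : realType) (I : dyadic_code) : R :=
  (dleft R I + dright R I) / 2.

Definition dset (R : realType) (I : dyadic_code) : set R :=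
  `[dleft R I, dright R I].
Arguments dset : clear implicits.

Definition lhalf (R : realType) (I : dyadic_code) : set R :=
  `[dleft R I, dmid R I].
Arguments lhalf : clear implicits.

Definition rhalf (R : realType) (I : dyadic_code) : set R :=
  `[dmid R I, dright R I].
Arguments rhalf : clear implicits.

Definition dyadic (R : realType) (M : nat) : set dyadic_code :=
  [set I : dyadic_code | - M%:Z <= I.1 <= M%:Z /\ dset R I `<=` `[0, 2 ^+ M]].

Definition lacunary_tile (R : realType) (I : dyadic_code) : set (R * R) :=
  dset R I `*` `[(dlen R I)^-1, 2 / dlen R I].
Arguments lacunary_tile : clear implicits.

Definition phi (R : realType) (I : dyadic_code) (x : R) : R[i] :=
  ((Num.sqrt (dlen R I))^-1)%:C * (\1_(lhalf R I) x - \1_(rhalf R I) x).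

Definition avg (R : realType) (f : R -> R[i]) (I : dyadic_code) : R[i] :=
  ((dlen R I)^-1)%:C * cintegral (dset R I) f.

Definition wavelet_coef (R : realType) (f : R -> R[i]) (I : dyadic_code) :
    R[i] :=
  cintegral setT (fun x => f x * phi I x).

(* The linear span of all phi_P and all indicators of dyadic intervals. *)
Definition haar_span (R : realType) (M : nat) : set (R -> R[i]) :=
  [set f | exists a b : dyadic_code -> R[i], forall x : R,
     f x = \sum_(I \in dyadic R M) (a I * phi I x + b I * \1_(dset R I) x)].

(* By [lacunary_tile_inj] below, summing over the lacunary tiles P = P^+(I) is
   summing over the dyadic intervals I = I_P; the sums are finite by
   [finite_dyadic]. *)

Definition pi_hl (R : realType) (M : nat) (f g : R -> R[i]) (x : R) : R[i] :=
  \sum_(I \in dyadic R M) wavelet_coef f I * avg g I * phi I x.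

Definition pi_lh (R : realType) (M : nat) (f g : R -> R[i]) (x : R) : R[i] :=
  \sum_(I \in dyadic R M) avg f I * wavelet_coef g I * phi I x.

Definition pi_hh (R : realType) (M : nat) (f g : R -> R[i]) (x : R) : R[i] :=
  \sum_(I \in dyadic R M)
    wavelet_coef f I * wavelet_coef g I * (\1_(dset R I) x / (dlen R I)%:C).

Lemma dlen_gt0 (R : realType) (I : dyadic_code) : 0 < dlen R I.
Proof. by rewrite /dlen exprz_gt0. Qed.

Lemma dright_dleft (R : realType) (I : dyadic_code) :
  dright R I = dleft R I + dlen R I.
Proof. by rewrite /dright /dleft /dlen intrD mulrDl mul1r. Qed.

Lemma finite_dyadic (R : realType) (M : nat) : finite_set (dyadic R M).
Proof.
pose F (ab : nat * nat) : dyadic_code := (ab.1%:Z - M%:Z, ab.2%:Z).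
apply: (@sub_finite_set _ _ (F @` (`I_(M + M).+1 `*` `I_(2 ^ (M + M)).+1))).
  move=> [k j] [/= /andP[kl ku] sub].
  have L0 := dlen_gt0 R (k, j).
  have lr := dright_dleft R (k, j).
  have : dset R (k, j) (dleft R (k, j)).
    by rewrite /dset/= in_itv/= lexx lr lerDl ltW.
  move=> /sub/=; rewrite in_itv/= => /andP[l0 lM].
  have {sub lM}rM : dright R (k, j) <= 2 ^+ M.
    have : dset R (k, j) (dright R (k, j)).
      by rewrite /dset/= in_itv/= lexx lr lerDl ltW.
    by move=> /sub/=; rewrite in_itv/= => /andP[].
  have j0 : 0 <= j.
    by move: l0; rewrite /dleft/= pmulr_lge0 ?exprz_gt0// ler0z.
  have jM : j <= (2 ^ (M + M))%:Z.
    rewrite -(@ler_int R).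
    have : dleft R (k, j) <= 2 ^+ M by rewrite (le_trans _ rM)// lr lerDl ltW.
    rewrite /dleft/= -ler_pdivlMr ?exprz_gt0// => /le_trans; apply.
    rewrite -pmulrn natrX exprD ler_pM2l ?exprn_gt0// invr_expz.
    have -> : (2 : R) ^+ M = 2 ^ M%:Z by [].
    by rewrite ler_weXz2l ?ler1n//; lia.
  exists (absz (k + M%:Z), absz j) => /=.
    by split => /=; lia.
  by rewrite /F/=; congr pair; lia.
by apply: finite_image; apply: finite_setX; apply: finite_II.
Qed.

Lemma lacunary_tile_inj (R : realType) : injective (lacunary_tile R).
Proof.
move=> [k j] [k' j'] e.
have H (I J : dyadic_code) : lacunary_tile R I = lacunary_tile R J ->
    dleft R J <= dleft R I /\ (dlen R J)^-1 <= (dlen R I)^-1.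
  move=> IJ.
  have : lacunary_tile R I (dleft R I, (dlen R I)^-1).
    split; rewrite /dset/= in_itv/= lexx/=.
      by rewrite dright_dleft lerDl ltW// dlen_gt0.
    by rewrite ler_peMl ?ler1n// invr_ge0 ltW// dlen_gt0.
  by rewrite IJ => -[]; rewrite /dset/= !in_itv/= => /andP[-> _] /andP[-> _].
have [a1 b1] := H _ _ e.
have [a2 b2] := H _ _ (esym e).
have : (dlen R (k, j))^-1 = (dlen R (k', j'))^-1.
  by apply/eqP; rewrite eq_le b1 b2.
have n21 : (2 : R) != 1 by rewrite pnatr_eq1.
move=> /invr_inj /(ieexprIz (ltr0n R 2) n21)/= kk.
have : dleft R (k, j) = dleft R (k', j') by apply/eqP; rewrite eq_le a1 a2.
rewrite /dleft/= kk => /mulIf; rewrite expfz_neq0 ?pnatr_eq0// => /(_ isT).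
by move=> /intr_inj ->.
Qed.

(* Main.v *)
(** Haar coefficients and dyadic averages turn the paraproducts into sums over
    the generations of a binary tree, pi_hl being the sum of the terms
    [+- (df)_I [g]_I], where [(df)_I] is half the difference of the averages of
    [f] over the two halves of [I]. Normalise so that the level is 1. Descending
    the tree, as long as the averages of [|f|] and [g] stay at most 1, pi_hl is a
    martingale transform of [f] by a multiplier bounded by 1, controlled by a
    Burkholder-type function [U] of even degree [s >= p] that is concave along
    the directions [(h, k)] with [|k| <= |h|]; [|f|^s] is then at most a constant
    times [|f|^p]. Once an average exceeds 1, Jensen's inequality makes the mean
    of [|f|^p] or [|g|^q] larger than the trivial bound 1 for the measure. This
    gives a bound by [|f|_p^p + |g|_q^q], and homogeneity turns it into the weak
    type estimate. By symmetry the same holds for pi_lh, and pi_hh is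
    [f g - [f][g] - pi_hl - pi_lh]. *)

Require Import Defs.
From mathcomp Require Import all_boot all_order all_algebra.
From mathcomp Require Import complex.
From mathcomp Require Import all_classical all_reals all_analysis.
From mathcomp Require Import measurable_realfun.
From mathcomp Require Import ring lra zify.
Import Order.TTheory GRing.Theory Num.Theory.
Import numFieldNormedType.Exports.

Set Implicit Arguments.
Unset Strict Implicit.
Unset Printing Implicit Defensive.
Local Open Scope classical_set_scope.
Local Open Scope ring_scope.

(** * A zigzag-concave majorant of an even power *)

Section ZigzagConcavity.
Context {R : realFieldType}.
Implicit Types x y h k : R.

(** Induction on [n]: the difference at exponent [n.+2] is [y] times the previous difference plus
    [k] times a sum of powers. A polynomial form of the mean value bound. *)
Lemma normr_exp_diff_le y k n :
  `|(y + k) ^+ n.+1 - (y - k) ^+ n.+1|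
    <= 2 * n.+1%:R * `|k| * (`|y| + `|k|) ^+ n.
Proof.
elim: n => [|n IH].
  by rewrite !expr1 expr0 !mulr1 (_ : _ - _ = 2 * k) ?normrM ?(@ger0_norm _ 2)//; ring.
have -> : (y + k) ^+ n.+2 - (y - k) ^+ n.+2 =
    y * ((y + k) ^+ n.+1 - (y - k) ^+ n.+1)
    + k * ((y + k) ^+ n.+1 + (y - k) ^+ n.+1) by rewrite !(exprS _ n.+1); ring.
rewrite (le_trans (ler_normD _ _))// !normrM.
have T : `|(y + k) ^+ n.+1 + (y - k) ^+ n.+1| <= 2 * (`|y| + `|k|) ^+ n.+1.
  rewrite (le_trans (ler_normD _ _))// !normrX mulr_natl mulr2n lerD//.
    by rewrite lerXn2r ?nnegrE ?addr_ge0// ler_normD.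
  by rewrite lerXn2r ?nnegrE ?addr_ge0// ler_normB.
have Z0 : 0 <= (`|y| + `|k|) ^+ n by rewrite exprn_ge0 ?addr_ge0.
have D : `|y| * `|(y + k) ^+ n.+1 - (y - k) ^+ n.+1| <=
    2 * n.+1%:R * `|k| * (`|y| + `|k|) ^+ n.+1.
  apply: (@le_trans _ _ (`|y| * (2 * n.+1%:R * `|k| * (`|y| + `|k|) ^+ n))).
    by rewrite ler_wpM2l.
  rewrite (exprS _ n) mulrCA ler_wpM2l ?mulr_ge0// ler_wpM2r//.
  by rewrite lerDl.
have := ler_wpM2l (normr_ge0 k) T.
move: D; rewrite -[n.+2%:R]natr1; lra.
Qed.

(** A Taylor estimate without derivatives: the second difference obeys a recurrence whose error is
    [k] times the first difference. It measures how far the power of [y] is from being concave. *)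
Lemma exp_second_diff_le y k n :
  (y + k) ^+ n.+2 + (y - k) ^+ n.+2 - 2 * y ^+ n.+2
    <= n.+2%:R * n.+1%:R * k ^+ 2 * (`|y| + `|k|) ^+ n.
Proof.
(* The induction needs the two-sided bound, because the recurrence multiplies by [y], whose sign is
   free. *)
apply: le_trans (ler_norm _) _.
elim: n => [|n IH].
  rewrite expr0 (_ : _ - _ = 2 * k ^+ 2); last by ring.
  by rewrite !mulr1 ger0_norm// mulr_ge0 ?sqr_ge0.
have -> : (y + k) ^+ n.+3 + (y - k) ^+ n.+3 - 2 * y ^+ n.+3 =
    y * ((y + k) ^+ n.+2 + (y - k) ^+ n.+2 - 2 * y ^+ n.+2)
    + k * ((y + k) ^+ n.+2 - (y - k) ^+ n.+2) by rewrite !(exprS _ n.+2); ring.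
rewrite (le_trans (ler_normD _ _))// !normrM.
have Z0 : 0 <= (`|y| + `|k|) ^+ n by rewrite exprn_ge0 ?addr_ge0.
have A : `|y| * `|(y + k) ^+ n.+2 + (y - k) ^+ n.+2 - 2 * y ^+ n.+2| <=
    n.+2%:R * n.+1%:R * k ^+ 2 * (`|y| + `|k|) ^+ n.+1.
  apply: (@le_trans _ _ (`|y| * (n.+2%:R * n.+1%:R * k ^+ 2 * (`|y| + `|k|) ^+ n))).
    by rewrite ler_wpM2l.
  rewrite (exprS _ n) mulrCA ler_wpM2l//; first by rewrite mulr_ge0 ?sqr_ge0.
  rewrite ler_wpM2r//.
  by rewrite lerDl.
have B := ler_wpM2l (normr_ge0 k) (normr_exp_diff_le y k n.+1).
apply: le_trans (lerD A B) _.
rewrite -(real_normK (num_real k)) -!natr1.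
apply: le_trans (_ : _ <= (n%:R + 1 + 1 + 1) * (n%:R + 1 + 1) * `|k| ^+ 2 *
  (`|y| + `|k|) ^+ n.+1) _ => //.
by rewrite le_eqVlt; apply/orP; left; apply/eqP; ring.
Qed.

(** Quantitative convexity of even powers. Raising the exponent by two ([step]) yields the term in
    [x ^+ n], and iterating from exponent 2 ([base]) yields the term in [h ^+ n]. *)
Lemma exp_second_diff_ge x h n : ~~ odd n ->
  h ^+ 2 * (x ^+ n + h ^+ n)
    <= (x + h) ^+ n.+2 + (x - h) ^+ n.+2 - 2 * x ^+ n.+2.
Proof.
have step m : ~~ odd m ->
    (x ^+ 2 + h ^+ 2) * ((x + h) ^+ m + (x - h) ^+ m - 2 * x ^+ m)
      + 2 * h ^+ 2 * x ^+ m
    <= (x + h) ^+ m.+2 + (x - h) ^+ m.+2 - 2 * x ^+ m.+2.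
  move=> /even_halfK <-; rewrite -muln2 mulnC; set j := m./2.
  have -> : ((2 * j).+2 = 2 + 2 * j)%N by [].
  rewrite !(exprD _ 2 (2 * j)).
  (* The cross term is nonnegative: the difference of powers factors through (x + h)^2 - (x - h)^2 =
     4xh, and the other factor is a sum of products of squares. *)
  have : 0 <= 2 * (x * h) * ((x + h) ^+ (2 * j) - (x - h) ^+ (2 * j)).
    rewrite !(exprM _ 2 j) subrXX [X in 0 <= X]mulrA; apply: mulr_ge0.
      have -> : 2 * (x * h) * ((x + h) ^+ 2 - (x - h) ^+ 2) = 8 * (x * h) ^+ 2.
        by ring.
      by rewrite mulr_ge0// sqr_ge0.
    by apply: sumr_ge0 => i _; rewrite mulr_ge0// exprn_ge0// sqr_ge0.
  by lra.
have base m : ~~ odd m -> (0 < m)%N ->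
    2 * h ^+ m <= (x + h) ^+ m + (x - h) ^+ m - 2 * x ^+ m.
  move=> /even_halfK <-; case: (m./2) => // j _.
  elim: j => [|j IH]; first by rewrite -[1.*2]/2%N; lra.
  have e : ~~ odd j.+1.*2 by rewrite odd_double.
  rewrite doubleS; apply: le_trans (step _ e).
  have xe : 0 <= x ^+ j.+1.*2 by rewrite -mul2n exprM exprn_ge0// sqr_ge0.
  have he : 0 <= h ^+ j.+1.*2 by rewrite -mul2n exprM exprn_ge0// sqr_ge0.
  have h2 : 0 <= h ^+ 2 by exact: sqr_ge0.
  have x2 : 0 <= x ^+ 2 by exact: sqr_ge0.
  have := ler_wpM2l h2 IH.
  have : 0 <= x ^+ 2 * ((x + h) ^+ j.+1.*2 + (x - h) ^+ j.+1.*2 - 2 * x ^+ j.+1.*2).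
    by rewrite mulr_ge0// (le_trans _ IH)// mulr_ge0.
  have : 0 <= h ^+ 2 * x ^+ j.+1.*2 by rewrite mulr_ge0.
  have -> : h ^+ j.+1.*2.+2 = h ^+ 2 * h ^+ j.+1.*2 by rewrite -exprD.
  by lra.
move=> e; case: n e => [|n] e; first by rewrite !expr0; have := sqr_ge0 h; lra.
have xe : 0 <= x ^+ n.+1 by rewrite exprn_even_ge0.
have he : 0 <= h ^+ n.+1 by rewrite exprn_even_ge0.
apply: le_trans (step _ e).
have IH := base _ e isT.
have h2 : 0 <= h ^+ 2 by exact: sqr_ge0.
have := ler_wpM2l h2 IH.
have : 0 <= x ^+ 2 * ((x + h) ^+ n.+1 + (x - h) ^+ n.+1 - 2 * x ^+ n.+1).
  by rewrite mulr_ge0 ?sqr_ge0// (le_trans _ IH)// mulr_ge0.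
have : 0 <= h ^+ 2 * x ^+ n.+1 by rewrite mulr_ge0.
have : 0 <= h ^+ 2 * h ^+ n.+1 by rewrite mulr_ge0.
by lra.
Qed.

(** Young's inequality with a free weight [e] and natural exponents: whichever of [a] and [e * b] is
    larger, one term on the right suffices. *)
Lemma young_exp (e a b : R) n : 0 < e -> 0 <= a -> 0 <= b ->
  a * b ^+ n <= e * b ^+ n.+1 + (e^-1) ^+ n * a ^+ n.+1.
Proof.
move=> e0 a0 b0; have [ab|ba] := leP a (e * b).
  apply: ler_wpDr; first by rewrite mulr_ge0// exprn_ge0// invr_ge0 ltW.
  by rewrite exprS mulrA ler_wpM2r// exprn_ge0.
apply: ler_wpDl; first by rewrite mulr_ge0 ?exprn_ge0// ltW.
rewrite exprS mulrCA ler_wpM2l// -exprMn lerXn2r ?nnegrE//.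
  by rewrite mulr_ge0// invr_ge0 ltW.
by rewrite ler_pdivlMl// ltW.
Qed.

Lemma exp_sum_le (a b : R) n : 0 <= a -> 0 <= b ->
  (a + b) ^+ n <= 2 ^+ n * (a ^+ n + b ^+ n).
Proof.
move=> a0 b0; have [ab|/ltW ba] := leP a b.
  apply: (@le_trans _ _ ((2 * b) ^+ n)).
    by rewrite lerXn2r ?nnegrE ?mulr_ge0 ?addr_ge0//; lra.
  by rewrite exprMn ler_wpM2l ?exprn_ge0// lerDr exprn_ge0.
apply: (@le_trans _ _ ((2 * a) ^+ n)).
  by rewrite lerXn2r ?nnegrE ?mulr_ge0 ?addr_ge0//; lra.
by rewrite exprMn ler_wpM2l ?exprn_ge0// lerDl exprn_ge0.
Qed.

(* Burkholder's method with U(x, y) = y^s - a x^2 y^(s-2) - b x^s: the middle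
   term supplies the concavity in x that beats the convexity of y^s, and the
   last one absorbs the errors. *)
Lemma zigzag_concave_majorant s : ~~ odd s -> (4 <= s)%N ->
  exists U : R -> R -> R, exists2 K : R, 0 < K &
   [/\ forall x y h k, `|k| <= `|h| ->
         U (x + h) (y + k) + U (x - h) (y - k) <= 2 * U x y,
       forall x y, y ^+ s <= U x y + K * x ^+ s
     & forall x, U x 0 <= 0].
Proof.
case: s => [|[|[|m]]]// es _; pose n := m.+1.
have en : ~~ odd n by move: es; rewrite /= !negbK.
(* [c] is the constant of [S1]. The weight [e] makes [4 * n%:R * e * 2 ^+ n] equal to 1 in the use
   of Young's inequality in [S4], and [d] is the coefficient that [x ^+ n] then receives. *)
pose c : R := n.+2%:R * n.+1%:R * 2 ^+ n.
have c0 : 0 < c by rewrite !mulr_gt0// exprn_gt0.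
pose e : R := (4 * n%:R * 2 ^+ n)^-1.
have e0 : 0 < e by rewrite invr_gt0 !mulr_gt0// exprn_gt0.
pose d : R := 4 * n%:R * (e^-1) ^+ m.
have d0 : 0 < d by rewrite !mulr_gt0// exprn_gt0// invr_gt0.
(* In the second difference of [U] the terms in [y ^+ n] cancel and c h^2 (2 h^n + d x^n) is left
   over; b = c (d + 2) dominates both coefficients. *)
pose b := c + c * (d + 1).
have b0 : 0 < b by rewrite /b addr_gt0// mulr_gt0// addr_gt0.
pose U x y : R := y ^+ n.+2 - c * x ^+ 2 * y ^+ n - b * x ^+ n.+2.
have zig x y h k : `|k| <= `|h| ->
    U (x + h) (y + k) + U (x - h) (y - k) <= 2 * U x y.
  move=> kh.
  have k2h2 : k ^+ 2 <= h ^+ 2.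
    by rewrite -(real_normK (num_real k)) -(real_normK (num_real h)) lerXn2r ?nnegrE.
  have yn : 0 <= y ^+ n by rewrite exprn_even_ge0.
  have xn : 0 <= x ^+ n by rewrite exprn_even_ge0.
  have hn : 0 <= h ^+ n by rewrite exprn_even_ge0.
  have nn (z : R) : `|z| ^+ n = z ^+ n.
    by rewrite -normrX; apply: ger0_norm; rewrite exprn_even_ge0.
  have Zn : (`|y| + `|k|) ^+ n <= 2 ^+ n * (y ^+ n + h ^+ n).
    rewrite -(nn y) -(nn h) (le_trans _ (exp_sum_le _ _ _))//.
    by rewrite lerXn2r ?nnegrE ?addr_ge0// lerD2l.
  have Z0 : 0 <= `|y| + `|k| by rewrite addr_ge0.
  have Zn0 : 0 <= (`|y| + `|k|) ^+ n by rewrite exprn_ge0.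
  have S1 : (y + k) ^+ n.+2 + (y - k) ^+ n.+2 - 2 * y ^+ n.+2 <=
      c * (h ^+ 2 * (y ^+ n + h ^+ n)).
    apply: le_trans (exp_second_diff_le _ _ _) _.
    have kZ : k ^+ 2 * (`|y| + `|k|) ^+ n <= h ^+ 2 * (2 ^+ n * (y ^+ n + h ^+ n)).
      by apply: ler_pM => //; exact: sqr_ge0.
    have nn0 : 0 <= n.+2%:R * n.+1%:R :> R by rewrite mulr_ge0.
    by have := ler_wpM2l nn0 kZ; rewrite /c; lra.
  have S2 := exp_second_diff_ge x h en.
  have S3 : 2 * y ^+ n <= (y + k) ^+ n + (y - k) ^+ n.
    have [m' mE] : exists m', n = m'.+2.
      by exists m.-1; move: en; rewrite /n; case: (m).
    have ek : ~~ odd m' by move: en; rewrite mE /= negbK.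
    have := exp_second_diff_ge y k ek; rewrite -mE.
    have : 0 <= k ^+ 2 * (y ^+ m' + k ^+ m').
      by rewrite mulr_ge0 ?sqr_ge0 ?addr_ge0 ?exprn_even_ge0.
    by lra.
  (* The mixed term of the second difference of x^2 y^n has no sign. Young's inequality trades it
     for at most half of the gain 2 h^2 y^n, plus errors left to [b]. *)
  have S4 : `|2 * (x * h) * ((y + k) ^+ n - (y - k) ^+ n)| <=
       h ^+ 2 * (y ^+ n + h ^+ n + d * x ^+ n).
    rewrite !normrM (@ger0_norm _ 2)//.
    have xh0 : 0 <= 2 * (`|x| * `|h|) by rewrite !mulr_ge0.
    apply: le_trans (ler_wpM2l xh0 (normr_exp_diff_le y k m)) _; rewrite -/n.
    apply: (@le_trans _ _ (2 * (`|x| * `|h|) * (2 * n%:R * `|h| * (`|y| + `|k|) ^+ m))).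
      apply: ler_wpM2l => //; apply: ler_wpM2r; first exact: exprn_ge0.
      by apply: ler_wpM2l; rewrite ?mulr_ge0.
    have -> : 2 * (`|x| * `|h|) * (2 * n%:R * `|h| * (`|y| + `|k|) ^+ m) =
       h ^+ 2 * (4 * n%:R * (`|x| * (`|y| + `|k|) ^+ m)).
      by rewrite -(real_normK (num_real h)); ring.
    rewrite ler_wpM2l ?sqr_ge0//.
    have := young_exp m e0 (normr_ge0 x) Z0; rewrite -/n nn => Y.
    have n4 : 0 <= 4 * n%:R :> R by rewrite mulr_ge0.
    apply: le_trans (ler_wpM2l n4 Y) _.
    rewrite mulrDr mulrA [X in _ + X]mulrA lerD//.
    apply: le_trans (_ : _ <= 4 * n%:R * e * (2 ^+ n * (y ^+ n + h ^+ n))) _.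
      by rewrite ler_wpM2l// mulr_ge0// ltW.
    rewrite le_eqVlt; apply/orP; left; apply/eqP.
    rewrite mulrA -[RHS]mul1r; congr (_ * _).
    rewrite /e mulrAC mulfV// mulf_neq0 ?expf_neq0 ?pnatr_eq0//.
    by rewrite mulf_neq0 ?pnatr_eq0.
  have S5 : h ^+ 2 * (y ^+ n - h ^+ n - d * x ^+ n) <=
     (x + h) ^+ 2 * (y + k) ^+ n + (x - h) ^+ 2 * (y - k) ^+ n - 2 * x ^+ 2 * y ^+ n.
    have -> : (x + h) ^+ 2 * (y + k) ^+ n + (x - h) ^+ 2 * (y - k) ^+ n =
       (x ^+ 2 + h ^+ 2) * ((y + k) ^+ n + (y - k) ^+ n) +
       2 * (x * h) * ((y + k) ^+ n - (y - k) ^+ n) by ring.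
    have xh : 0 <= x ^+ 2 + h ^+ 2 by rewrite addr_ge0// sqr_ge0.
    have := ler_wpM2l xh S3; move: S4; rewrite ler_norml => /andP[+ _].
    by lra.
  have := ler_wpM2l (ltW c0) S5; have := ler_wpM2l (ltW b0) S2.
  move: S1; rewrite /U.
  have : 0 <= c * d * (h ^+ 2 * h ^+ n).
    apply: mulr_ge0; first by rewrite mulr_ge0 ?(ltW c0) ?(ltW d0).
    by rewrite mulr_ge0 ?sqr_ge0.
  have : 0 <= c * (h ^+ 2 * x ^+ n).
    apply: mulr_ge0; first exact: ltW.
    by rewrite mulr_ge0 ?sqr_ge0.
  by rewrite /b; lra.
(* Doubling keeps a full [y ^+ s] after the middle term has consumed half of it, when y^2 >= 2 c
   x^2. In the opposite case [y ^+ n] is itself bounded by a multiple of [x ^+ n], which fixes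
   [K]. *)
exists (fun x y => 2 * U x y).
exists (2 * (b + c * (2 * c) ^+ n./2)).
  by rewrite mulr_gt0// addr_gt0// mulr_gt0// exprn_gt0// mulr_gt0.
split.
- by move=> x y h k kh; have := zig x y h k kh; lra.
- move=> x y; rewrite /U.
  have yn : 0 <= y ^+ n by rewrite exprn_even_ge0.
  have xn : 0 <= x ^+ n by rewrite exprn_even_ge0.
  have x2 := sqr_ge0 x; have y2 := sqr_ge0 y.
  have zE (z : R) : z ^+ n.+2 = z ^+ 2 * z ^+ n by rewrite -exprD.
  rewrite !zE.
  have [H|/ltW H] := leP (2 * c * x ^+ 2) (y ^+ 2).
    have := ler_wpM2r yn H.
    have : 0 <= c * (2 * c) ^+ n./2 * (x ^+ 2 * x ^+ n).
      rewrite mulr_ge0// mulr_ge0//; first exact: ltW.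
      by rewrite exprn_ge0// mulr_ge0// ltW.
    by lra.
  have Hn : y ^+ n <= (2 * c) ^+ n./2 * x ^+ n.
    have nE : n = (2 * n./2)%N by rewrite mul2n even_halfK.
    rewrite {1 3}nE !exprM -exprMn lerXn2r ?nnegrE//.
    by rewrite mulr_ge0// mulr_ge0// ltW.
  have := ler_wpM2l (mulr_ge0 (ltW c0) x2) Hn.
  have : 0 <= y ^+ 2 * y ^+ n by rewrite mulr_ge0.
  by lra.
- move=> x; rewrite /U !expr0n/= mulr0 subr0 sub0r mulrN oppr_le0 mulr_ge0//.
  by rewrite mulr_ge0 ?(ltW b0)// exprn_even_ge0.
Qed.

End ZigzagConcavity.

(** * Paraproducts on a finite binary tree *)

Section DyadicAverages.
Context {K : numFieldType}.
Implicit Types X Y : nat -> K.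

(** Node [j] at height [m] of a binary tree stands for a block of [2 ^ m] consecutive leaves; its
    children are [j.*2] and [j.*2.+1]. *)
Definition av X m j : K := (\sum_(j * 2 ^ m <= i < j.+1 * 2 ^ m) X i) / 2 ^+ m.

Definition dif X m j : K := (av X m j.*2 - av X m j.*2.+1) / 2.

(** The ancestor of leaf [i] at height [l.+1] is [i %/ 2 ^ l.+1], and [i] lies in its left half
    exactly when [i %/ 2 ^ l] is even; the sign is thus the unnormalised Haar function at [i]. In
    [hh] the sign is squared away. *)
Definition hl X Y m i : K :=
  \sum_(l < m) (-1) ^+ (i %/ 2 ^ l) * dif X l (i %/ 2 ^ l.+1)
                 * av Y l.+1 (i %/ 2 ^ l.+1).

Definition hh X Y m i : K :=
  \sum_(l < m) dif X l (i %/ 2 ^ l.+1) * dif Y l (i %/ 2 ^ l.+1).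

Lemma divn_block m j i :
  (j * 2 ^ m <= i < j.+1 * 2 ^ m)%N -> (i %/ 2 ^ m)%N = j.
Proof.
move=> /andP[ji ij]; apply/eqP; rewrite eqn_leq leq_divRL ?expn_gt0// ji andbT.
by rewrite -ltnS ltn_divLR ?expn_gt0.
Qed.

Lemma av0 X j : av X 0 j = X j.
Proof. by rewrite /av expn0 !muln1 big_nat1 expr0 divr1. Qed.

Lemma avS X m j : av X m.+1 j = (av X m j.*2 + av X m j.*2.+1) / 2.
Proof.
have e1 : (j.*2 * 2 ^ m = j * 2 ^ m.+1)%N by rewrite expnS; lia.
have e2 : (j.*2.+2 * 2 ^ m = j.+1 * 2 ^ m.+1)%N by rewrite expnS; lia.
rewrite /av e1 e2 exprS invfM mulrA -mulrDl.
rewrite (big_cat_nat (n := (j.*2.+1 * 2 ^ m)%N))/=; last 2 first.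
- by rewrite -e1 leq_mul2r leqnSn orbT.
- by rewrite -e2 leq_mul2r leqnSn orbT.
by rewrite mulrAC.
Qed.

Lemma eq_av X Y m j :
  (forall i, (j * 2 ^ m <= i < j.+1 * 2 ^ m)%N -> X i = Y i) ->
  av X m j = av Y m j.
Proof. by move=> XY; rewrite /av (eq_big_nat _ _ XY). Qed.

Lemma avD X Y m j : av (fun i => X i + Y i) m j = av X m j + av Y m j.
Proof. by rewrite /av big_split mulrDl. Qed.

Lemma avZ c X m j : av (fun i => c * X i) m j = c * av X m j.
Proof. by rewrite /av -mulr_sumr mulrA. Qed.

Lemma difZ c X m j : dif (fun i => c * X i) m j = c * dif X m j.
Proof. by rewrite /dif !avZ -mulrBr mulrA. Qed.

Lemma hlS X Y m i : hl X Y m.+1 i = hl X Y m i +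
  (-1) ^+ (i %/ 2 ^ m) * dif X m (i %/ 2 ^ m.+1) * av Y m.+1 (i %/ 2 ^ m.+1).
Proof. by rewrite /hl big_ord_recr. Qed.

Lemma hlZ c d X Y m i :
  hl (fun i => c * X i) (fun i => d * Y i) m i = c * d * hl X Y m i.
Proof.
rewrite /hl mulr_sumr; apply: eq_bigr => l _.
by rewrite difZ avZ; ring.
Qed.

Lemma hhZ c d X Y m i :
  hh (fun i => c * X i) (fun i => d * Y i) m i = c * d * hh X Y m i.
Proof.
rewrite /hh mulr_sumr; apply: eq_bigr => l _.
by rewrite !difZ; ring.
Qed.

Lemma divn_pow2S i l : (i %/ 2 ^ l.+1)%N = (i %/ 2 ^ l)./2.
Proof. by rewrite -divn2 -divnMA expnSr. Qed.

Lemma av_dif X i l : av X l (i %/ 2 ^ l) =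
  av X l.+1 (i %/ 2 ^ l.+1) + (-1) ^+ (i %/ 2 ^ l) * dif X l (i %/ 2 ^ l.+1).
Proof.
rewrite divn_pow2S; set k := (i %/ 2 ^ l)%N.
rewrite avS /dif -{1}(odd_double_half k) -signr_odd.
by case: (odd k) => /=; rewrite ?add1n ?add0n ?expr1 ?expr0; field.
Qed.

(** By [av_dif] each average is its parent's plus a signed increment. Multiplying out the product of
    two averages at each height gives one term of each paraproduct, and the products telescope from
    leaf to root. *)
Lemma paraproduct_decomposition X Y m i :
  hh X Y m i = X i * Y i - av X m (i %/ 2 ^ m) * av Y m (i %/ 2 ^ m)
               - hl X Y m i - hl Y X m i.
Proof.
elim: m => [|m IH].
  by rewrite /hh /hl !big_ord0 expn0 divn1 !av0; ring.
rewrite /hh big_ord_recr /= -/(hh X Y m i) IH !hlS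
  (av_dif X i m) (av_dif Y i m).
have s2 : ((-1) ^+ (i %/ 2 ^ m)) ^+ 2 = 1 :> K by rewrite sqrr_sign.
set s := (-1) ^+ _ in s2 *.
transitivity (s ^+ 2 * (dif X m (i %/ 2 ^ m.+1) * dif Y m (i %/ 2 ^ m.+1))
   + (X i * Y i -
  (av X m.+1 (i %/ 2 ^ m.+1) + s * dif X m (i %/ 2 ^ m.+1)) *
  (av Y m.+1 (i %/ 2 ^ m.+1) + s * dif Y m (i %/ 2 ^ m.+1)) -
  hl X Y m i - hl Y X m i)); first by rewrite s2; ring.
by ring.
Qed.

End DyadicAverages.

(** * Monotonicity and Jensen's inequality for dyadic averages *)

Section RealAverages.
Context {R : realFieldType}.
Implicit Types X Y : nat -> R.

Lemma ler_av X Y m j :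
  (forall i, (j * 2 ^ m <= i < j.+1 * 2 ^ m)%N -> X i <= Y i) ->
  av X m j <= av Y m j.
Proof.
move=> XY; rewrite /av ler_wpM2r ?invr_ge0 ?exprn_ge0//.
by rewrite !big_nat; apply: ler_sum.
Qed.

Lemma av_ge0 X m j : (forall i, 0 <= X i) -> 0 <= av X m j.
Proof.
by move=> X0; rewrite /av mulr_ge0 ?sumr_ge0 ?invr_ge0 ?exprn_ge0.
Qed.

Lemma av_le1 X m j : (forall i, X i <= 1) -> av X m j <= 1.
Proof.
move=> X1; elim: m j => [|m IH] j; first by rewrite av0.
by rewrite avS; have := IH j.*2; have := IH j.*2.+1; lra.
Qed.

(** Jensen's inequality: a dyadic average is an iterated midpoint, so midpoint convexity is
    enough. *)
Lemma av_midpoint_convex (K : numFieldType) (f : K -> R) (X : nat -> K) m j :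
  (forall x y, f ((x + y) / 2) <= (f x + f y) / 2) ->
  f (av X m j) <= av (f \o X) m j.
Proof.
move=> fc; elim: m j => [|m IH] j; first by rewrite !av0.
by rewrite !avS; have := fc (av X m j.*2) (av X m j.*2.+1);
  have := IH j.*2; have := IH j.*2.+1; lra.
Qed.

End RealAverages.

(** * The weak type bound at level 1 for real sequences *)

Section WeakTypeReal.
Context {R : realType}.
Implicit Types F G : nat -> R.

Lemma powR_midpoint_convex (p a b : R) : 1 <= p -> 0 <= a -> 0 <= b ->
  ((a + b) / 2) `^ p <= (a `^ p + b `^ p) / 2.
Proof.
move=> p1 a0 b0.
have -> : (a + b) / 2 = 2^-1 * a + (1 - 2^-1) * b by lra.
have -> : (a `^ p + b `^ p) / 2 = 2^-1 * a `^ p + (1 - 2^-1) * b `^ p by lra.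
by apply: (convex_powR p1 (Itv01 _ _)) => //=; rewrite ?inE/= ?in_itv/= ?andbT//; lra.
Qed.

Lemma norm_powR_midpoint_convex (p x y : R) : 1 <= p ->
  `|(x + y) / 2| `^ p <= (`|x| `^ p + `|y| `^ p) / 2.
Proof.
move=> p1; apply: le_trans (powR_midpoint_convex p1 (normr_ge0 x) (normr_ge0 y)).
apply: ge0_ler_powR; rewrite ?nnegrE ?divr_ge0 ?addr_ge0//; first lra.
by rewrite normrM (@ger0_norm _ 2^-1)// ler_wpM2r// ler_normD.
Qed.

(** Bounding the surplus factor u^(s - p) by 2^(s - p) lets the even integer degree of the majorant
    replace the real exponent [p] as long as averages stay bounded. *)
Lemma exp_le_powR (p u : R) s : 1 <= p <= s%:R -> 0 <= u <= 2 ->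
  u ^+ s <= 2 ^+ s * u `^ p.
Proof.
move=> /andP[p1 ps] /andP[u0 u2].
have [->|un0] := eqVneq u 0.
  have : (1 : R) <= s%:R by lra.
  rewrite ler1n => /prednK <-; rewrite exprS mul0r mulr_ge0 ?powR_ge0 ?exprn_ge0//.
rewrite -!powR_mulrn// -[s%:R in leLHS](subrK p) powRD; last by rewrite un0 implybT.
rewrite ler_wpM2r ?powR_ge0//.
apply: (@le_trans _ _ (2 `^ (s%:R - p))).
  by apply: ge0_ler_powR; rewrite ?nnegrE//; lra.
by apply: ler_powR; lra.
Qed.

Lemma ler_norm_powR (p x : R) : 1 <= p -> 1 <= `|x| -> 1 <= `|x| `^ p.
Proof. by move=> p1 x1; apply: le_trans (le1r_powR x1 p1). Qed.

(* Induction on the dyadic scale. Once an average of |F| or G exceeds 1, the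
   averages of |F|^p or |G|^q already dominate the trivial bound 1; until then
   each step is a martingale transform step with multiplier at most 1, to which
   the zigzag concavity of U applies. *)
Lemma hl_bellman_bound s (p q : R) (U : R -> R -> R) (K : R) :
  ~~ odd s -> 1 <= p <= s%:R -> 1 <= q -> 0 < K ->
  (forall x y h k, `|k| <= `|h| ->
     U (x + h) (y + k) + U (x - h) (y - k) <= 2 * U x y) ->
  (forall x y, y ^+ s <= U x y + K * x ^+ s) ->
  forall F G m j y, av (fun i => `|F i|) m j <= 2 ->
  av (fun i => (1 <= `|y + hl F G m i|)%R%:R) m j <=
    (1 + K * 2 ^+ s) * av (fun i => `|F i| `^ p) m j
    + av (fun i => `|G i| `^ q) m j + U (av F m j) y.
Proof.
move=> es ps q1 K0 zig maj F G.
have p1 : 1 <= p by case/andP: ps.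
have jensen (t : R) (X : nat -> R) m j : 1 <= t ->
    `|av X m j| `^ t <= av (fun i => `|X i| `^ t) m j.
  by move=> t1; apply: (av_midpoint_convex (f := fun x => `|x| `^ t)) => x y;
    exact: norm_powR_midpoint_convex.
have normav (X : nat -> R) m j : `|av X m j| <= av (fun i => `|X i|) m j.
  have tri (x y : R) : `|(x + y) / 2| <= (`|x| + `|y|) / 2.
    by rewrite normrM (@ger0_norm _ 2^-1)// ler_wpM2r// ler_normD.
  exact: (@av_midpoint_convex R R (fun x => `|x|) X m j tri).
have U0 m j y : av (fun i => `|F i|) m j <= 2 ->
    y ^+ s <= U (av F m j) y + K * 2 ^+ s * av (fun i => `|F i| `^ p) m j.
  move=> F2; apply: le_trans (maj (av F m j) y) _.
  rewrite lerD2l -mulrA ler_wpM2l ?(ltW K0)//.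
  apply: (@le_trans _ _ (2 ^+ s * `|av F m j| `^ p)); last first.
    by rewrite ler_wpM2l ?exprn_ge0// jensen.
  rewrite -[av F m j ^+ s]ger0_norm ?exprn_even_ge0// normrX.
  by apply: exp_le_powR; rewrite // normr_ge0 (le_trans (normav _ _ _)).
have Ys (y : R) : 0 <= y ^+ s by rewrite exprn_even_ge0.
have Fp0 m j : 0 <= av (fun i => `|F i| `^ p) m j by apply: av_ge0 => i; exact: powR_ge0.
have Gq0 m j : 0 <= av (fun i => `|G i| `^ q) m j by apply: av_ge0 => i; exact: powR_ge0.
elim=> [|m IH] j y F2.
  have := U0 _ _ y F2; have := Gq0 0 j; have := Fp0 0 j.
  rewrite !av0 /hl big_ord0 addr0.
  case: (leP 1 `|y|) => [y1|_]; last by have := Ys y; rewrite /=; lra.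
  have : 1 <= y ^+ s.
    by rewrite -[y ^+ s]ger0_norm ?Ys// normrX exprn_ege1.
  by rewrite /=; lra.
have V1 : av (fun i => (1 <= `|y + hl F G m.+1 i|)%R%:R) m.+1 j <= 1 :> R.
  by apply: av_le1 => i; rewrite lern1 leq_b1.
have := U0 _ _ y F2; have := Gq0 m.+1 j; have := Fp0 m.+1 j; have := Ys y.
(* In the two stopping cases the trivial bound [V1] suffices: [U0] and [Ys] make the [U] term plus
   its correction nonnegative, and Jensen puts one of the remaining averages above 1. *)
have [F1|F1] := ltP 1 (av (fun i => `|F i|) m.+1 j).
  have F0 : 0 <= av (fun i => `|F i|) m.+1 j by lra.
  have : 1 <= av (fun i => `|F i| `^ p) m.+1 j.
    have := jensen p (fun i => `|F i|) m.+1 j p1.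
    under [X in _ <= X -> _]eq_av do rewrite normr_id.
    apply: le_trans; apply: ler_norm_powR => //.
    by rewrite ger0_norm// ltW.
  by lra.
have [G1|G1] := ltP 1 `|av G m.+1 j|.
  have : 1 <= av (fun i => `|G i| `^ q) m.+1 j.
    by apply: le_trans (jensen _ _ _ _ q1); apply: ler_norm_powR => //; exact: ltW.
  by lra.
move=> _ _ _ _.
have h0 i : 0 <= `|F i| by [].
(* A nonnegative average at most 1 can at most double on passing to a child; hence the bound 2 in
   the induction hypothesis against the stopping threshold 1. *)
have [l2 r2] : av (fun i => `|F i|) m j.*2 <= 2 /\ av (fun i => `|F i|) m j.*2.+1 <= 2.
  have := av_ge0 m j.*2 h0; have := av_ge0 m j.*2.+1 h0.
  by move: F1; rewrite avS => *; split; lra.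
(* The top term of [hl] is constant on each half, [d * g] on the left and its opposite on the right,
   so it is absorbed into [y]. Since |g| <= 1, the step is admissible for [zig]. *)
pose d := dif F m j; pose g := av G m.+1 j.
have Vl : av (fun i => (1 <= `|y + hl F G m.+1 i|)%R%:R) m j.*2 =
    av (fun i => (1 <= `|(y + d * g) + hl F G m i|)%R%:R) m j.*2 :> R.
  apply: eq_av => i /divn_block ij.
  rewrite hlS divn_pow2S ij doubleK -signr_odd odd_double expr0 mul1r -/d -/g.
  by congr (nat_of_bool (1 <= `|_|)%R)%:R; ring.
have Vr : av (fun i => (1 <= `|y + hl F G m.+1 i|)%R%:R) m j.*2.+1 =
    av (fun i => (1 <= `|(y - d * g) + hl F G m i|)%R%:R) m j.*2.+1 :> R.
  apply: eq_av => i /divn_block ij.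
  rewrite hlS divn_pow2S ij /= uphalf_double -signr_odd /= odd_double expr1.
  rewrite -/d -/g mulN1r mulNr.
  by congr (nat_of_bool (1 <= `|_|)%R)%:R; ring.
rewrite (avS (fun i => (_ <= _)%R%:R)) Vl Vr.
have := IH _ (y + d * g) l2; have := IH _ (y - d * g) r2.
have dg : `|d * g| <= `|d| by rewrite normrM ler_piMr.
have := zig (av F m.+1 j) y d (d * g) dg.
have -> : av F m.+1 j + d = av F m j.*2 by rewrite avS /d /dif; lra.
have -> : av F m.+1 j - d = av F m j.*2.+1 by rewrite avS /d /dif; lra.
rewrite (avS (fun i => `|F i| `^ p)) (avS (fun i => `|G i| `^ q)).
by lra.
Qed.

(** Started at y = 0, the Bellman bound loses its [U] term, because U(x, 0) <= 0. If the root
    average of |F| already exceeds 2, Jensen and the trivial bound conclude. *)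
Lemma hl_weak_type_real (p q : R) : 1 < p -> 1 < q ->
  exists2 C : R, 0 < C & forall F G m j,
    av (fun i => (1 <= `|hl F G m i|)%R%:R) m j <=
      C * (av (fun i => `|F i| `^ p) m j + av (fun i => `|G i| `^ q) m j).
Proof.
move=> p1 q1.
have [n pn] : exists n : nat, p <= n%:R.
  exists (Num.truncn p).+1; apply: ltW.
  by have /andP[] := @truncn_itv R p (ltW (lt_trans ltr01 p1)).
pose s := (n + 2).*2.
have es : ~~ odd s by rewrite odd_double.
have s4 : (4 <= s)%N by rewrite /s; lia.
have ps : 1 <= p <= s%:R.
  by rewrite (ltW p1) (le_trans pn)// ler_nat /s; lia.
have [U [K K0 [zig maj U0]]] := @zigzag_concave_majorant R s es s4.
have KS : 0 < K * 2 ^+ s by rewrite mulr_gt0// exprn_gt0.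
exists (1 + K * 2 ^+ s); first lra.
move=> F G m j.
have Fp0 : 0 <= av (fun i => `|F i| `^ p) m j by apply: av_ge0 => i; exact: powR_ge0.
have Gq0 : 0 <= av (fun i => `|G i| `^ q) m j by apply: av_ge0 => i; exact: powR_ge0.
have := mulr_ge0 (ltW KS) Gq0; have := mulr_ge0 (ltW KS) Fp0.
have [F2|F2] := leP (av (fun i => `|F i|) m j) 2.
  have := hl_bellman_bound es ps (ltW q1) K0 zig maj G 0 F2.
  under eq_av do rewrite add0r.
  by have := U0 (av F m j); lra.
have : av (fun i => (1 <= `|hl F G m i|)%R%:R) m j <= 1 :> R.
  by apply: av_le1 => i; rewrite lern1 leq_b1.
have : 1 <= av (fun i => `|F i| `^ p) m j.
  have := @av_midpoint_convex R R (fun x => `|x| `^ p) (fun i => `|F i|) m j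
    (fun x y => norm_powR_midpoint_convex x y (ltW p1)).
  under [X in _ <= X -> _]eq_av do rewrite /= normr_id.
  apply: le_trans; apply: ler_norm_powR; first exact: ltW.
  by rewrite ger0_norm; lra.
by lra.
Qed.

End WeakTypeReal.

(** * Complex sequences, and the weak type bounds for the other two paraproducts *)

Section WeakTypeComplex.
Context {R : realType}.
Local Notation C := R[i]%C.
Local Notation nc := (@Normc.normc R).
Implicit Types F G X : nat -> C.

Lemma normc_ge0 (z : C) : 0 <= nc z.
Proof. by case: z => a b; exact: sqrtr_ge0. Qed.

Lemma normc_real (a : R) : nc a%:C%C = `|a|.
Proof. by rewrite /Normc.normc /= expr0n addr0 sqrtr_sqr. Qed.

Lemma normc_le_ReIm (z : C) : nc z <= `|complex.Re z| + `|complex.Im z|.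
Proof.
case: z => a b /=; rewrite -[leRHS]ger0_norm ?addr_ge0// -sqrtr_sqr.
apply: ler_wsqrtr; rewrite sqrrD !real_normK ?num_real//.
by rewrite -addrA lerD2l lerDr mulrn_wge0 ?mulr_ge0.
Qed.

Lemma normr_Re_le (z : C) : `|complex.Re z| <= nc z.
Proof.
by case: z => a b /=; rewrite -sqrtr_sqr ler_wsqrtr// lerDl sqr_ge0.
Qed.

Lemma normr_Im_le (z : C) : `|complex.Im z| <= nc z.
Proof.
by case: z => a b /=; rewrite -sqrtr_sqr ler_wsqrtr// lerDr sqr_ge0.
Qed.

Lemma half_complex (z : C) :
  z / 2 = (complex.Re z / 2 +i* (complex.Im z / 2))%C.
Proof.
have -> : (2 : C)^-1 = (2^-1 : R)%:C%C by rewrite fmorphV rmorph_nat.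
by case: z => a b; apply/eqP; rewrite eq_complex/= !mulr0 subr0 add0r !eqxx.
Qed.

Lemma Re_half_sum (x y : C) :
  complex.Re ((x + y) / 2) = (complex.Re x + complex.Re y) / 2.
Proof. by rewrite half_complex; case: x y => [a b] [c d]. Qed.

Lemma Im_half_sum (x y : C) :
  complex.Im ((x + y) / 2) = (complex.Im x + complex.Im y) / 2.
Proof. by rewrite half_complex; case: x y => [a b] [c d]. Qed.

Lemma Re_av X m j : complex.Re (av X m j) = av (fun i => complex.Re (X i)) m j.
Proof.
elim: m j => [|m IH] j; first by rewrite !av0.
by rewrite !avS Re_half_sum !IH.
Qed.

Lemma Im_av X m j : complex.Im (av X m j) = av (fun i => complex.Im (X i)) m j.
Proof.
elim: m j => [|m IH] j; first by rewrite !av0.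
by rewrite !avS Im_half_sum !IH.
Qed.

Lemma Re_dif X m j :
  complex.Re (dif X m j) = dif (fun i => complex.Re (X i)) m j.
Proof.
rewrite /dif -!Re_av half_complex /=.
by case: (av X m j.*2) (av X m j.*2.+1) => [a b] [c d].
Qed.

Lemma Im_dif X m j :
  complex.Im (dif X m j) = dif (fun i => complex.Im (X i)) m j.
Proof.
rewrite /dif -!Im_av half_complex /=.
by case: (av X m j.*2) (av X m j.*2.+1) => [a b] [c d].
Qed.

(** The Haar signs are real and [hl] is bilinear, so the complex case reduces to four real ones. *)
Lemma hl_complexE F G m i :
  let Fr k := complex.Re (F k) in let Fi k := complex.Im (F k) in
  let Gr k := complex.Re (G k) in let Gi k := complex.Im (G k) in
  hl F G m i = ((hl Fr Gr m i - hl Fi Gi m i)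
                +i* (hl Fr Gi m i + hl Fi Gr m i))%C.
Proof.
move=> Fr Fi Gr Gi; elim: m => [|m IH].
  by rewrite /hl !big_ord0 subr0 addr0.
rewrite !hlS IH -!(signr_odd _ (i %/ 2 ^ m)).
have := Re_dif F m (i %/ 2 ^ m.+1); have := Im_dif F m (i %/ 2 ^ m.+1).
have := Re_av G m.+1 (i %/ 2 ^ m.+1); have := Im_av G m.+1 (i %/ 2 ^ m.+1).
rewrite -/Fr -/Fi -/Gr -/Gi.
move: (dif F m _) (av G m.+1 _) => [a b] [c d] /= <- <- <- <-.
by case: odd; rewrite ?expr1 ?expr0 ?mulN1r ?mul1r; apply/eqP; rewrite eq_complex /=;
  apply/andP; split; apply/eqP; ring.
Qed.

Lemma normc_powR_midpoint_convex (p : R) (x y : C) : 1 <= p ->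
  nc ((x + y) / 2) `^ p <= (nc x `^ p + nc y `^ p) / 2.
Proof.
move=> p1; apply: le_trans (powR_midpoint_convex p1 (normc_ge0 x) (normc_ge0 y)).
apply: ge0_ler_powR; rewrite ?nnegrE ?divr_ge0 ?addr_ge0 ?normc_ge0//; first lra.
have -> : (2 : C)^-1 = (2^-1 : R)%:C%C by rewrite fmorphV rmorph_nat.
by rewrite Normc.normcM normc_real ger0_norm// ler_wpM2r// le_normcD.
Qed.

(** Pigeonhole: used to cover the level set of a sum of four terms by four level sets. *)
Lemma sum_ge4_indic (a b c d : R) : 4 <= a + b + c + d ->
  1 <= (1 <= a)%R%:R + (1 <= b)%R%:R + (1 <= c)%R%:R + (1 <= d)%R%:R :> R.
Proof.
move=> abcd; rewrite -!natrD ler1n.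
case: (leP 1 a) => // a1; case: (leP 1 b) => // b1.
by case: (leP 1 c) => // c1; case: (leP 1 d) => // d1; lra.
Qed.

(** The average of the indicator is the normalised measure of a level set. Level 1 is enough for
    bihomogeneous operators, by [weak_type_scaled]. *)
Definition weak_type (p q : R)
    (T : (nat -> C) -> (nat -> C) -> nat -> nat -> C) :=
  exists2 K : R, 0 < K & forall F G m j,
    av (fun i => (1 <= nc (T F G m i))%R%:R) m j <=
      K * (av (fun i => nc (F i) `^ p) m j + av (fun i => nc (G i) `^ q) m j).

Lemma hl_weak_type (p q : R) : 1 < p -> 1 < q -> weak_type p q hl.
Proof.
move=> p1 q1; have [K K0 w] := hl_weak_type_real p1 q1.
pose K' := 4 * K * (2 `^ p + 2 `^ q).
have p20 : 0 < 2 `^ p by rewrite powR_gt0.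
have q20 : 0 < 2 `^ q by rewrite powR_gt0.
exists K'; first by rewrite !mulr_gt0// addr_gt0.
move=> F G m j.
have p0 : 0 <= p by lra.
have q0 : 0 <= q by lra.
set fF := av (fun i => nc (F i) `^ p) m j.
set gG := av (fun i => nc (G i) `^ q) m j.
have fF0 : 0 <= fF by apply: av_ge0 => i; exact: powR_ge0.
have gG0 : 0 <= gG by apply: av_ge0 => i; exact: powR_ge0.
have bound (a b : C -> R) : (forall z, `|a z| <= nc z) -> (forall z, `|b z| <= nc z) ->
    av (fun i => (1 <= 4 * `|hl (fun k => a (F k)) (fun k => b (G k)) m i|)%R%:R) m j
      <= K * (2 `^ p + 2 `^ q) * (fF + gG).
  move=> aC bC.
  (* Doubling both arguments multiplies [hl] by 4, which is the level that the pigeonhole over four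
     pieces requires. *)
  have := w (fun k => 2 * a (F k)) (fun k => 2 * b (G k)) m j.
  under eq_av do rewrite hlZ normrM -natrM (@ger0_norm _ 4)//.
  move=> /le_trans; apply; rewrite -mulrA ler_wpM2l ?(ltW K0)//.
  have H (t : R) (c : C -> R) (X : nat -> C) : 0 <= t -> (forall z, `|c z| <= nc z) ->
      av (fun i => `|2 * c (X i)| `^ t) m j <= 2 `^ t * av (fun i => nc (X i) `^ t) m j.
    move=> t0 cC; rewrite -avZ; apply: ler_av => i _.
    rewrite normrM (@ger0_norm _ 2)// powRM// ler_wpM2l ?powR_ge0//.
    by apply: ge0_ler_powR; rewrite ?nnegrE ?normc_ge0.
  have := H p a F p0 aC; have := H q b G q0 bC; rewrite -/fF -/gG.
  have := mulr_ge0 (ltW p20) gG0; have := mulr_ge0 (ltW q20) fF0.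
  by lra.
have rr := bound _ _ normr_Re_le normr_Re_le.
have ii := bound _ _ normr_Im_le normr_Im_le.
have ri := bound _ _ normr_Re_le normr_Im_le.
have ir := bound _ _ normr_Im_le normr_Re_le.
have : K' * (fF + gG) = K * (2 `^ p + 2 `^ q) * (fF + gG) +
  K * (2 `^ p + 2 `^ q) * (fF + gG) + K * (2 `^ p + 2 `^ q) * (fF + gG) +
  K * (2 `^ p + 2 `^ q) * (fF + gG) by rewrite /K'; ring.
move=> ->; apply: le_trans (lerD (lerD (lerD rr ii) ri) ir).
rewrite -!avD; apply: ler_av => i _; rewrite hl_complexE.
set x := hl _ _ _ _; set y := hl _ _ _ _; set z := hl _ _ _ _; set t := hl _ _ _ _.
have := normc_le_ReIm ((x - y) +i* (z + t))%C.
set v := ((x - y) +i* (z + t))%C; rewrite -[complex.Re v]/(x - y) -[complex.Im v]/(z + t).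
move=> nv; have nxy := ler_normB x y; have nzt := ler_normD z t.
case: (leP 1 (nc v)) => [h1|_]; last by rewrite !addr_ge0.
by apply: sum_ge4_indic; clear -h1 nv nxy nzt; lra.
Qed.

Lemma lh_weak_type (p q : R) : 1 < p -> 1 < q ->
  weak_type p q (fun F G => hl G F).
Proof.
move=> p1 q1; have [K K0 w] := hl_weak_type q1 p1.
by exists K => // F G m j; rewrite addrC.
Qed.

(** By [paraproduct_decomposition], [hh] splits into four terms: the pointwise product, the product
    of root averages, and two [hl] terms. The product and the root term account for the 2 in the
    constant, the others for [K] and [L]. *)
Lemma hh_weak_type (p q : R) : 1 < p -> 1 < q -> weak_type p q hh.
Proof.
move=> p1 q1; have [K K0 w] := hl_weak_type p1 q1.
have [L L0 v] := lh_weak_type p1 q1.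
have p20 : 0 < 2 `^ p by rewrite powR_gt0.
have q20 : 0 < 2 `^ q by rewrite powR_gt0.
exists ((2 + K + L) * (2 `^ p + 2 `^ q)); first by rewrite mulr_gt0// !addr_gt0.
move=> F G m j.
have nc2 (z : C) : nc (2 * z) = 2 * nc z.
  have -> : (2 : C) = (2 : R)%:C%C by rewrite rmorph_nat.
  by rewrite Normc.normcM normc_real ger0_norm.
pose F' i := 2 * F i; pose G' i := 2 * G i.
have powE (t : R) (X : nat -> C) :
    av (fun i => nc (2 * X i) `^ t) m j = 2 `^ t * av (fun i => nc (X i) `^ t) m j.
  by rewrite -avZ; apply: eq_av => i _; rewrite nc2 powRM ?normc_ge0.
have := w F' G' m j; have := v F' G' m j.
have pF := powE p F; have qG := powE q G; rewrite /F' /G' pF qG -/F' -/G'.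
set fF := av (fun i => nc (F i) `^ p) m j in pF *.
set gG := av (fun i => nc (G i) `^ q) m j in qG *.
have fF0 : 0 <= fF by apply: av_ge0 => i; exact: powR_ge0.
have gG0 : 0 <= gG by apply: av_ge0 => i; exact: powR_ge0.
move=> v' w'.
(* A product of modulus at least 1 has a factor of modulus at least 1. *)
have ind (a b : C) : (1 <= nc (a * b))%R%:R <= nc a `^ p + nc b `^ q :> R.
  have a0 := powR_ge0 (nc a) p; have b0 := powR_ge0 (nc b) q.
  have na := normc_ge0 a; have nb := normc_ge0 b.
  case: (leP 1 (nc (a * b))) => [|_]; last by rewrite addr_ge0.
  rewrite Normc.normcM mulr1n => ab.
  have [a1|a1] := leP 1 (nc a).
    by have := le1r_powR a1 (ltW p1); lra.
  have [b1|b1] := leP 1 (nc b).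
    by have := le1r_powR b1 (ltW q1); lra.
  by nra.
have prod : av (fun i => (1 <= nc (F' i * G' i))%R%:R) m j <= 2 `^ p * fF + 2 `^ q * gG.
  by rewrite -pF -qG -avD; apply: ler_av => i _; exact: ind.
have jen (t : R) (X : nat -> C) : 1 < t ->
    nc (av X m j) `^ t <= av (fun i => nc (X i) `^ t) m j.
  move=> t1; exact: (@av_midpoint_convex R C (fun x => nc x `^ t) X m j
    (fun x y => normc_powR_midpoint_convex x y (ltW t1))).
have root : (1 <= nc (av F' m j * av G' m j))%R%:R <= 2 `^ p * fF + 2 `^ q * gG.
  by apply: le_trans (ind _ _) _; rewrite -pF -qG lerD// jen.
have avc (c : R) k l : av (fun=> c) k l = c.
  by elim: k l => [|k IH] l; rewrite ?av0// avS !IH; lra.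
apply: (@le_trans _ _ (av (fun i => (1 <= nc (F' i * G' i))%R%:R) m j +
   av (fun i => (1 <= nc (av F' m j * av G' m j))%R%:R) m j +
   av (fun i => (1 <= nc (hl F' G' m i))%R%:R) m j +
   av (fun i => (1 <= nc (hl G' F' m i))%R%:R) m j)); last first.
  rewrite avc.
  have := mulr_ge0 (ltW p20) gG0; have := mulr_ge0 (ltW q20) fF0.
  have := mulr_ge0 (ltW K0) (mulr_ge0 (ltW p20) gG0).
  have := mulr_ge0 (ltW K0) (mulr_ge0 (ltW q20) fF0).
  have := mulr_ge0 (ltW L0) (mulr_ge0 (ltW p20) gG0).
  have := mulr_ge0 (ltW L0) (mulr_ge0 (ltW q20) fF0).
  by move: v' w' prod root; lra.
rewrite -!avD; apply: ler_av => i /divn_block ij.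
have := paraproduct_decomposition F' G' m i; rewrite ij {1}/F' {1}/G' hhZ.
set a := F' i * G' i; set b := _ * av G' m j.
set c := hl F' _ _ _; set d := hl G' _ _ _ => /(congr1 nc).
rewrite -mulrA !nc2 => e.
have := le_normcD (a - b - c) (- d); have := le_normcD (a - b) (- c).
have := le_normcD a (- b); rewrite !normcN -e => h1 h2 h3.
case: (leP 1 (nc (hh F G m i))) => [h4|_]; last by rewrite !addr_ge0.
by apply: sum_ge4_indic; clear -h1 h2 h3 h4; lra.
Qed.

(** The level 1 bound is applied to F / A and G / B; the split of the level into [A * B] is left
    free for optimisation. *)
Lemma weak_type_scaled (p q : R) T : weak_type p q T ->
  (forall c d F G m i, T (fun k => c * F k) (fun k => d * G k) m i =
     c * d * T F G m i) ->
  exists2 K : R, 0 < K & forall F G m j (A B : R), 0 < A -> 0 < B ->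
    av (fun i => (A * B <= nc (T F G m i))%R%:R) m j <=
      K * (A `^ (- p) * av (fun i => nc (F i) `^ p) m j
           + B `^ (- q) * av (fun i => nc (G i) `^ q) m j).
Proof.
move=> [K K0 w] TZ; exists K => // F G m j A B A0 B0.
have := w (fun k => (A^-1)%:C%C * F k) (fun k => (B^-1)%:C%C * G k) m j.
have ncZ (c : R) (z : C) : 0 < c -> nc ((c^-1)%:C%C * z) = c^-1 * nc z.
  by move=> c0; rewrite Normc.normcM normc_real ger0_norm// invr_ge0 ltW.
have powE (t c : R) (X : nat -> C) : 0 < c ->
    av (fun i => nc ((c^-1)%:C%C * X i) `^ t) m j =
    c `^ (- t) * av (fun i => nc (X i) `^ t) m j.
  move=> c0; rewrite -avZ; apply: eq_av => i _.
  rewrite ncZ// powRM ?normc_ge0 ?invr_ge0 ?(ltW c0)//.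
  by rewrite -powR_inv1 ?(ltW c0)// -powRrM mulN1r.
rewrite !powE//; under eq_av do rewrite TZ -mulrA !ncZ// mulrA -invfM
  ler_pdivlMl ?mulr_gt0// mulr1.
by [].
Qed.

End WeakTypeComplex.
(** * Functions constant on the cells of a mesh *)

Section CellwiseConstant.
Context {R : realType}.
Local Notation mu := (@lebesgue_measure R).
Implicit Types (u v : R -> R) (a b : R).

Definition integrates u a :=
  mu.-integrable setT (EFin \o u) /\ (\int[mu]_x (u x)%:E = a%:E)%E.

Lemma integrates_itv (b0 b1 : bool) a b : a <= b ->
  integrates \1_[set` Interval (BSide b0 a) (BSide b1 b)] (b - a).
Proof.
move=> ab; split; first exact: integrable_indic_itv.
rewrite integral_indic; last 2 first.
- exact: measurableT.
- exact: measurable_itv.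
rewrite setIT; apply: etrans (lebesgue_measure_itv _) _.
rewrite /= lte_fin; case: ltP => // ba.
by rewrite (@le_anti _ _ a b) ?ab ?ba// subrr.
Qed.

Lemma integratesZ k u a : integrates u a ->
  integrates (fun x => k * u x) (k * a).
Proof.
move=> [iu ua]; split.
  rewrite (_ : _ \o _ = (fun x => k%:E * (EFin \o u) x)%E); last by apply/funext.
  exact: integrableZl.
by under eq_integral do rewrite EFinM; rewrite integralZl// ua.
Qed.

Lemma integratesD u v a b : integrates u a -> integrates v b ->
  integrates (fun x => u x + v x) (a + b).
Proof.
move=> [iu ua] [iv vb]; split.
  rewrite (_ : _ \o _ = ((EFin \o u) \+ (EFin \o v))%E); last by apply/funext.
  exact: integrableD.
by under eq_integral do rewrite EFinD; rewrite integralD// ua vb.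
Qed.

Lemma integrates_sum n (w : nat -> R -> R) (c : nat -> R) :
  (forall i, (i < n)%N -> integrates (w i) (c i)) ->
  integrates (fun x => \sum_(0 <= i < n) w i x) (\sum_(0 <= i < n) c i).
Proof.
elim: n => [|n IH] wc.
  have -> : (fun x => \sum_(0 <= i < 0) w i x) = (cst 0 : R -> R).
    by apply/funext => x; rewrite big_nil.
  rewrite big_nil; split; first exact: integrable0.
  exact: integral0.
have -> : (fun x => \sum_(0 <= i < n.+1) w i x) =
    (fun x => \sum_(0 <= i < n) w i x + w n x).
  by apply/funext => x; rewrite big_nat_recr.
rewrite big_nat_recr//=; apply: integratesD; last exact: wc.
by apply: IH => i ni; apply: wc; apply: ltnW.
Qed.

(** Half the shortest dyadic length, so that the halves of every dyadic interval are unions of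
    cells; [leaves M] counts the cells in [0, 2^M]. *)
Definition mesh M : R := (2 ^+ M.+1)^-1.

Definition mid M i : R := (i%:R + 2^-1) * mesh M.

Definition leaves M : nat := 2 ^ (M + M).+1.

(** Values at mesh points are left free: the closed halves and neighbouring closed intervals overlap
    there. *)
Definition cellwise (V : zmodType) M (u : R -> V) :=
  (forall i x, (i < leaves M)%N -> i%:R * mesh M < x < i.+1%:R * mesh M ->
     u x = u (mid M i))
  /\ (forall x, ~~ (0 <= x <= 2 ^+ M) -> u x = 0).

Lemma mesh_gt0 M : 0 < mesh M.
Proof. by rewrite invr_gt0 exprn_gt0. Qed.

Lemma leaves_mesh M : (leaves M)%:R * mesh M = 2 ^+ M.
Proof.
by rewrite /leaves /mesh natrX -addnS exprD mulfK// expf_neq0 ?pnatr_eq0.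
Qed.

Lemma mid_bounds M i : i%:R * mesh M < mid M i < i.+1%:R * mesh M.
Proof.
have m0 := mesh_gt0 M; rewrite /mid !ltr_pM2r// -[i.+1%:R]natr1.
by apply/andP; split; lra.
Qed.

Lemma cell_le M i n x : i%:R * mesh M < x < i.+1%:R * mesh M ->
  (n%:R * mesh M <= x) = (n <= i)%N.
Proof.
move=> /andP[ix xi]; have m0 := mesh_gt0 M; apply/idP/idP => [nx|ni].
  have := le_lt_trans nx xi; rewrite ltr_pM2r// ltr_nat ltnS; exact.
by apply: le_trans (ltW ix); rewrite ler_pM2r// ler_nat.
Qed.

Lemma cell_ge M i n x : i%:R * mesh M < x < i.+1%:R * mesh M ->
  (x <= n%:R * mesh M) = (i < n)%N.
Proof.
move=> /andP[ix xi]; have m0 := mesh_gt0 M; apply/idP/idP => [nx|ni].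
  have := lt_le_trans ix nx; rewrite ltr_pM2r// ltr_nat; exact.
by apply: le_trans (ltW xi) _; rewrite ler_pM2r// ler_nat.
Qed.

Lemma cellwise_integrates M u : cellwise M u ->
  integrates u (mesh M * \sum_(0 <= i < leaves M) u (mid M i)).
Proof.
move=> [uc u0]; have m0 := mesh_gt0 M.
pose cell i : set R := [set` `]i%:R * mesh M, i.+1%:R * mesh M[].
pose pt i : set R := [set` `[i%:R * mesh M, i%:R * mesh M]].
have cellE i x : \1_(cell i) x = (i%:R * mesh M < x < i.+1%:R * mesh M)%R%:R :> R.
  by rewrite indicE mem_setE in_itv.
have ptE i x : \1_(pt i) x = (i%:R * mesh M == x)%R%:R :> R.
  by rewrite indicE mem_setE in_itv /= -eq_le.
(* [u] is an exact combination of indicators of open cells and of mesh points, the right end 2^M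
   included, whence the [.+1]. The point terms integrate to 0. *)
have uE : u = fun x =>
    \sum_(0 <= i < leaves M) u (mid M i) * \1_(cell i) x +
    \sum_(0 <= i < (leaves M).+1) u (i%:R * mesh M) * \1_(pt i) x.
  apply/funext => x; rewrite !big_mkord.
  have [x0|x0] := boolP (0 <= x <= 2 ^+ M); last first.
    rewrite u0// !big1 ?addr0// => i _.
      rewrite ptE; case: eqVneq => [ix|]; rewrite ?mulr0//.
      move: x0; rewrite -ix mulr_ge0 ?(ltW m0)//= -leaves_mesh ler_pM2r// ler_nat.
      by rewrite -ltnS ltn_ord.
    have iN := ltn_ord i.
    rewrite cellE; case: andP => [[ix xi]|]; rewrite ?mulr0//.
    move/negP: x0; case; rewrite (le_trans _ (ltW ix)) ?mulr_ge0 ?(ltW m0)//=.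
    by rewrite (le_trans (ltW xi))// -leaves_mesh ler_pM2r// ler_nat.
  have /andP[x1 x2] := x0.
  have xm : 0 <= x / mesh M by rewrite divr_ge0// ltW.
  pose k := Num.truncn (x / mesh M).
  have /andP[kx xk] := truncn_itv xm; rewrite -/k in kx xk.
  rewrite ler_pdivlMr// in kx; rewrite ltr_pdivrMr// in xk.
  have [xE|xE] := eqVneq x (k%:R * mesh M).
    have kN : (k < (leaves M).+1)%N.
      by move: x2; rewrite xE -leaves_mesh ler_pM2r// ler_nat.
    rewrite big1 ?add0r; last first.
      move=> i _; rewrite cellE xE !ltr_pM2r// !ltr_nat ltnS.
      by case: ltngtP; rewrite ?mulr0.
    rewrite (bigD1 (Ordinal kN))//= big1 ?addr0; last first.
      move=> i; rewrite -val_eqE/= => ik.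
      have mn0 : mesh M != 0 by rewrite gt_eqF.
      by rewrite ptE xE (inj_eq (mulIf mn0)) eqr_nat (negbTE ik) mulr0.
    by rewrite ptE xE eqxx mulr1.
  have xc : k%:R * mesh M < x < k.+1%:R * mesh M by rewrite lt_neqAle eq_sym xE kx.
  have kN : (k < leaves M)%N by move: x2; rewrite -leaves_mesh (cell_ge _ xc).
  rewrite [X in _ + X]big1 ?addr0; last first.
    move=> i _; rewrite ptE; case: eqVneq => [ix|]; rewrite ?mulr0//.
    have := cell_le i xc; have := cell_ge i xc.
    by rewrite -ix lexx => /esym ki /esym; rewrite leqNgt ki.
  rewrite (bigD1 (Ordinal kN))//= big1 ?addr0; last first.
    move=> i; rewrite -val_eqE/= => ik.
    rewrite cellE; case: andP => [[ix xi]|]; rewrite ?mulr0//.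
    have := cell_le i xc; have := cell_ge i.+1 xc.
    rewrite (ltW ix) (ltW xi) ltnS => /esym ki /esym i_k.
    by move/negP: ik; case; rewrite eqn_leq ki i_k.
  by rewrite cellE xc mulr1; apply: uc.
have H1 i : integrates (fun x => u (mid M i) * \1_(cell i) x) (u (mid M i) * mesh M).
  apply: integratesZ; rewrite [X in integrates _ X](_ : _ = i.+1%:R * mesh M - i%:R * mesh M).
    by apply: integrates_itv; rewrite ler_pM2r// ler_nat.
  by rewrite -[i.+1%:R]natr1; ring.
have H2 i : integrates (fun x => u (i%:R * mesh M) * \1_(pt i) x) (u (i%:R * mesh M) * 0).
  apply: integratesZ; rewrite [X in integrates _ X](_ : _ = i%:R * mesh M - i%:R * mesh M).
    by apply: integrates_itv.
  by rewrite subrr.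
have := integratesD (@integrates_sum (leaves M) _ _ (fun i _ => H1 i))
  (@integrates_sum (leaves M).+1 _ _ (fun i _ => H2 i)).
rewrite -uE -mulr_suml mulrC [X in _ + X]big1 ?addr0// => i _.
by rewrite mulr0.
Qed.

Lemma cellwise_comp (V W : zmodType) M (u : R -> V) (h : V -> W) :
  h 0 = 0 -> cellwise M u -> cellwise M (h \o u).
Proof.
move=> h0 [uc u0]; split; first by move=> i x iM ix /=; rewrite (uc i).
by move=> x x0 /=; rewrite u0.
Qed.

Lemma cellwiseM (K : pzRingType) M (u v : R -> K) :
  cellwise M u -> cellwise M v -> cellwise M (fun x => u x * v x).
Proof.
move=> [uc u0] [vc v0]; split; first by move=> i x iM ix; rewrite (uc i)// (vc i).
by move=> x x0; rewrite u0// mul0r.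
Qed.

Lemma cellwise_fsum (V : zmodType) M (T : choiceType) (D : set T) (w : T -> R -> V) :
  (forall I, D I -> cellwise M (w I)) ->
  cellwise M (fun x => \sum_(I \in D) w I x).
Proof.
move=> wc; split=> [i x iM ix|x x0].
  by apply: eq_fsbigr => I /[!inE] DI; apply: (wc I DI).1.
by apply: fsbig1 => I DI; apply: (wc I DI).2.
Qed.

Lemma cellwise_measure M (A : set R) : cellwise M (\1_A : R -> R) ->
  mu A = (mesh M * \sum_(0 <= i < leaves M) \1_A (mid M i))%:E.
Proof.
move=> /cellwise_integrates[iA <-].
have /measurable_EFinP mI := measurable_int _ iA.
have mA := (@measurable_indicP _ _ R A).2 mI.
by rewrite integral_indic// setIT.
Qed.

End CellwiseConstant.
(** * Haar coefficients at the cell midpoints *)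

Section DyadicCodes.
Context {R : realType}.
Local Notation C := R[i]%C.

(** The scale is shifted to a natural number: this interval covers [2 ^ l.+1] cells and is the tree
    node [j] at height [l.+1]. *)
Definition code M l j : dyadic_code := (l%:Z - M%:Z, j%:Z).

Lemma dlen_code M l j : dlen R (code M l j) = 2 ^+ l.+1 * mesh M.
Proof.
rewrite /dlen /mesh /code /= expfzDr ?pnatr_eq0// -exprnN !exprS invfM.
rewrite -[2 ^ _]/(2 ^+ l); have : (2 : R) ^+ M != 0 by rewrite expf_neq0// pnatr_eq0.
by move=> ?; field.
Qed.

Lemma dleft_code M l j : dleft R (code M l j) = (j * 2 ^ l.+1)%:R * mesh M.
Proof.
by rewrite /dleft -[2 ^ _]/(dlen R (code M l j)) dlen_code natrM natrX mulrA.
Qed.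

Lemma dright_code M l j : dright R (code M l j) = (j.+1 * 2 ^ l.+1)%:R * mesh M.
Proof.
rewrite dright_dleft dleft_code dlen_code !natrM !natrX -[j.+1%:R]natr1.
by ring.
Qed.

Lemma dmid_code M l j : dmid R (code M l j) = (j.*2.+1 * 2 ^ l)%:R * mesh M.
Proof.
rewrite /dmid dleft_code dright_code !natrM !natrX -[j.+1%:R]natr1 -[j.*2.+1%:R]natr1.
by rewrite -muln2 natrM exprS; field.
Qed.

Lemma divn_pow2_eq m i j :
  (i %/ 2 ^ m == j)%N = (j * 2 ^ m <= i < j.+1 * 2 ^ m)%N.
Proof.
apply/eqP/idP => [<-|]; last exact: divn_block.
by rewrite leq_divM ltn_ceil ?expn_gt0.
Qed.

Lemma dset_code M l j : dset R (code M l j) =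
  `[(j * 2 ^ l.+1)%:R * mesh M, (j.+1 * 2 ^ l.+1)%:R * mesh M]%classic.
Proof. by rewrite /dset dleft_code dright_code. Qed.

Lemma lhalf_code M l j : lhalf R (code M l j) =
  `[(j.*2 * 2 ^ l)%:R * mesh M, (j.*2.+1 * 2 ^ l)%:R * mesh M]%classic.
Proof.
by rewrite /lhalf dleft_code dmid_code expnS mulnA muln2.
Qed.

Lemma rhalf_code M l j : rhalf R (code M l j) =
  `[(j.*2.+1 * 2 ^ l)%:R * mesh M, (j.*2.+2 * 2 ^ l)%:R * mesh M]%classic.
Proof.
by rewrite /rhalf dright_code dmid_code expnS mulnA muln2.
Qed.

Lemma dyadicP M I : dyadic R M I <-> exists l j,
  [/\ (l < (M + M).+1)%N, (j.+1 * 2 ^ l.+1 <= leaves M)%N & I = code M l j].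
Proof.
split=> [|[l [j [lM jN ->]]]].
  case: I => k j [/= /andP[kl ku] sub].
  have [l lE] : exists l : nat, k = l%:Z - M%:Z by exists (absz (k + M%:Z)); lia.
  rewrite {}lE in kl ku sub *.
  have lr : dleft R (l%:Z - M%:Z, j) <= dright R (l%:Z - M%:Z, j).
    by rewrite dright_dleft lerDl ltW// dlen_gt0.
  have : dset R (l%:Z - M%:Z, j) (dleft R (l%:Z - M%:Z, j)).
    by rewrite /dset/= in_itv/= lexx.
  move=> /sub/=; rewrite in_itv/= => /andP[l0 _].
  have j0 : 0 <= j.
    by move: l0; rewrite /dleft/= pmulr_lge0 ?exprz_gt0// ler0z.
  have [n nE] : exists n : nat, j = n%:Z by exists (absz j); lia.
  rewrite {}nE in sub lr *; exists l, n; split=> //; first by lia.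
  have : dset R (code M l n) (dright R (code M l n)) by rewrite /dset/= in_itv/= lexx lr.
  move=> /sub/=; rewrite in_itv/= => /andP[_].
  by rewrite dright_code -leaves_mesh ler_pM2r ?mesh_gt0// ler_nat.
split; first by rewrite /=; lia.
have m0 := @mesh_gt0 R M.
rewrite dset_code => x/=; rewrite !in_itv/= => /andP[xl xr].
rewrite (le_trans _ xl) ?mulr_ge0 ?(ltW m0)//= (le_trans xr)// -leaves_mesh.
by rewrite ler_pM2r// ler_nat.
Qed.

(** The end points are mesh points, so inside a cell membership depends only on the index [i] and
    becomes an ancestor test. *)
Lemma indic_itv_cell (K : pzRingType) M i x m j :
  i%:R * mesh M < x < i.+1%:R * mesh M ->
  \1_(`[(j * 2 ^ m)%:R * mesh M, (j.+1 * 2 ^ m)%:R * mesh M]%classic : set R) x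
    = (i %/ 2 ^ m == j)%N%:R :> K.
Proof.
move=> xi; rewrite indicE mem_setE in_itv/= (cell_le _ xi) (cell_ge _ xi).
by rewrite divn_pow2_eq.
Qed.

Lemma cellwise_indic_itv (K : pzRingType) M m j : (j.+1 * 2 ^ m <= leaves M)%N ->
  cellwise M (\1_(`[(j * 2 ^ m)%:R * mesh M, (j.+1 * 2 ^ m)%:R * mesh M]%classic : set R)
    : R -> K).
Proof.
move=> jN; have m0 := @mesh_gt0 R M; split=> [i x iN xi|x x0].
  by rewrite (indic_itv_cell _ _ _ xi) (indic_itv_cell _ _ _ (mid_bounds M i)).
rewrite indicE mem_setE in_itv/=; case: andP => // -[xl xr]; move/negP: x0; case.
rewrite (le_trans _ xl) ?mulr_ge0 ?(ltW m0)//= (le_trans xr)// -leaves_mesh.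
by rewrite ler_pM2r// ler_nat.
Qed.

Lemma cellwiseD (V : zmodType) M (u v : R -> V) :
  cellwise M u -> cellwise M v -> cellwise M (fun x => u x + v x).
Proof.
move=> [uc u0] [vc v0]; split; first by move=> i x iM ix; rewrite (uc i)// (vc i).
by move=> x x0; rewrite u0// v0// addr0.
Qed.

Lemma cellwiseZ (K : pzRingType) M c (u : R -> K) :
  cellwise M u -> cellwise M (fun x => c * u x).
Proof. exact: (cellwise_comp (h := fun z => c * z) (mulr0 c)). Qed.

Lemma dyadic_halves M l j : (j.+1 * 2 ^ l.+1 <= leaves M)%N ->
  (j.*2.+1 * 2 ^ l <= leaves M)%N /\ (j.*2.+2 * 2 ^ l <= leaves M)%N.
Proof.
have -> : (j.+1 * 2 ^ l.+1 = j.*2.+2 * 2 ^ l)%N by rewrite expnS mulnA muln2.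
by move=> h; split=> //; apply: leq_trans h; rewrite leq_mul2r leqnSn orbT.
Qed.

Lemma cellwise_dset M I : dyadic R M I -> cellwise M (\1_(dset R I) : R -> C).
Proof.
by move=> /dyadicP[l [j [_ jN ->]]]; rewrite dset_code; exact: cellwise_indic_itv.
Qed.

Lemma cellwise_phi M I : dyadic R M I -> cellwise M (phi I : R -> C).
Proof.
move=> /dyadicP[l [j [_ /dyadic_halves[j1 j2] ->]]].
apply: cellwiseZ; rewrite lhalf_code rhalf_code.
apply: cellwiseD; first exact: cellwise_indic_itv.
have := cellwiseZ (-1) (@cellwise_indic_itv C M l j.*2.+1 j2).
by rewrite (_ : (fun x => -1 * _) = (fun x => - \1_(`[(j.*2.+1 * 2 ^ l)%:R * mesh M,
  (j.*2.+2 * 2 ^ l)%:R * mesh M]%classic : set R) x)) //; apply/funext => x; rewrite mulN1r.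
Qed.

Lemma cellwise_haar_span M (f : R -> C) : haar_span M f -> cellwise M f.
Proof.
move=> [a [b fE]].
rewrite (_ : f = fun x => \sum_(I \in dyadic R M) (a I * phi I x + b I * \1_(dset R I) x)).
  apply: cellwise_fsum => I DI; apply: cellwiseD; apply: cellwiseZ.
    exact: cellwise_phi.
  exact: cellwise_dset.
exact/funext.
Qed.

Lemma phi_mid M l j i : phi (code M l j) (mid M i) =
  ((Num.sqrt (dlen R (code M l j)))^-1)%:C%C *
    ((i %/ 2 ^ l.+1 == j)%N%:R * (-1) ^+ (i %/ 2 ^ l)) :> C.
Proof.
rewrite /phi lhalf_code rhalf_code !(indic_itv_cell _ _ _ (mid_bounds M i)).
congr (_ * _); rewrite divn_pow2S; set k := (i %/ 2 ^ l)%N.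
rewrite -signr_odd -{1 2}(odd_double_half k); case: (odd k) => /=.
  rewrite add1n eqSS (inj_eq double_inj) expr1 mulrN1.
  by rewrite (_ : (_.+1 == _)%N = false) ?sub0r//; apply/negP => /eqP; lia.
rewrite add0n (inj_eq double_inj) expr0 mulr1.
by rewrite (_ : (_ == _.+1)%N = false) ?subr0//; apply/negP => /eqP; lia.
Qed.

Lemma sum_block (K : pzRingType) N (X : nat -> K) m j : (j.+1 * 2 ^ m <= N)%N ->
  \sum_(0 <= i < N) X i * (i %/ 2 ^ m == j)%N%:R =
  \sum_(j * 2 ^ m <= i < j.+1 * 2 ^ m) X i.
Proof.
move=> jN; rewrite [RHS](big_nat_widenl _ 0)// [RHS](big_nat_widen _ _ N)//.
rewrite [RHS]big_mkcond; apply: eq_bigr => i _.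
by rewrite divn_pow2_eq /=; case: ifP => _; rewrite ?mulr1 ?mulr0.
Qed.

Lemma cintegral_cellwise M (f : R -> C) : cellwise M f ->
  cintegral setT f = (mesh M)%:C%C * \sum_(0 <= i < leaves M) f (mid M i).
Proof.
move=> cf; rewrite /cintegral /Rintegral.
have ReD : {morph @complex.Re R : x y / x + y} by case=> a b [].
have ImD : {morph @complex.Im R : x y / x + y} by case=> a b [].
have [_ ->] := cellwise_integrates (cellwise_comp (h := @complex.Re R) erefl cf).
have [_ ->] := cellwise_integrates (cellwise_comp (h := @complex.Im R) erefl cf).
have Re0 : complex.Re (0 : C) = 0 by [].
have Im0 : complex.Im (0 : C) = 0 by [].
rewrite /= -(big_morph _ ReD Re0) -(big_morph _ ImD Im0).
by case: (\sum_(_ <= _ < _) _) => a b; apply/eqP; rewrite eq_complex/= !mul0r subr0 addr0 !eqxx.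
Qed.

Lemma cintegral_indic (D : set R) (f : R -> C) :
  cintegral D f = cintegral setT (fun x => f x * \1_D x).
Proof.
rewrite /cintegral /Rintegral; congr (fine _ +i* fine _)%C;
  rewrite integral_mkcond; apply: eq_integral => x _; rewrite /patch indicE;
  case: (x \in D) => /=; rewrite ?mulr1 ?mulr0//.
Qed.

Lemma avg_code M (f : R -> C) l j : cellwise M f -> (j.+1 * 2 ^ l.+1 <= leaves M)%N ->
  avg f (code M l j) = av (fun i => f (mid M i)) l.+1 j.
Proof.
move=> cf jN; rewrite /avg cintegral_indic dset_code (@cintegral_cellwise M); last first.
  by apply: cellwiseM => //; exact: cellwise_indic_itv.
under eq_bigr do rewrite (indic_itv_cell _ _ _ (mid_bounds M _)).
rewrite sum_block// dlen_code mulrA -rmorphM invfM -mulrA mulVf ?gt_eqF ?mesh_gt0//.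
by rewrite mulr1 /av mulrC fmorphV rmorphXn rmorph_nat.
Qed.

(** The factor is |I|^(1/2), written so that [sqrt_dlen] cancels it against the normalisation of
    [phi]. *)
Lemma wavelet_code M (f : R -> C) l j : cellwise M f ->
  (l < (M + M).+1)%N -> (j.+1 * 2 ^ l.+1 <= leaves M)%N ->
  wavelet_coef f (code M l j) =
    ((Num.sqrt (dlen R (code M l j)))^-1 * dlen R (code M l j))%:C%C
    * dif (fun i => f (mid M i)) l j.
Proof.
move=> cf lM jN; rewrite /wavelet_coef (@cintegral_cellwise M); last first.
  by apply: cellwiseM => //; apply: cellwise_phi; apply/dyadicP; exists l, j.
rewrite /phi; set s := (Num.sqrt _)^-1.
under eq_bigr do rewrite mulrCA lhalf_code rhalf_code
  !(indic_itv_cell _ _ _ (mid_bounds M _)) mulrBr.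
have [j1 j2] := dyadic_halves jN.
rewrite -mulr_sumr sumrB !sum_block// mulrA -rmorphM dlen_code /dif /av.
rewrite -mulrBl !rmorphM rmorphXn rmorph_nat exprS.
have : (2 : C) ^+ l != 0 by rewrite expf_neq0// pnatr_eq0.
by move=> ?; field.
Qed.

Lemma divn_block_leaves M i l : (i < leaves M)%N -> (l < (M + M).+1)%N ->
  ((i %/ 2 ^ l.+1).+1 * 2 ^ l.+1 <= leaves M)%N.
Proof.
move=> iN lM; have lN : leaves M = (2 ^ ((M + M).+1 - l.+1) * 2 ^ l.+1)%N.
  by rewrite /leaves -expnD subnK.
by rewrite lN leq_mul2r ltn_divLR ?expn_gt0// -lN iN orbT.
Qed.

(** A cell midpoint lies in exactly one dyadic interval of each scale, so the sum runs over the
    ancestors of leaf [i]. *)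
Lemma sum_dyadic_mid M i (T : dyadic_code -> C) : (i < leaves M)%N ->
  (forall l j, (i %/ 2 ^ l.+1 != j)%N -> T (code M l j) = 0) ->
  \sum_(I \in dyadic R M) T I = \sum_(l < (M + M).+1) T (code M l (i %/ 2 ^ l.+1)).
Proof.
move=> iN T0; rewrite (fsbig_ord _ _ (fun l => T (code M l (i %/ 2 ^ l.+1)))).
rewrite -(@fsbig_image _ _ _ _ _ _ (fun l => code M l (i %/ 2 ^ l.+1)) T); last first.
  by move=> l l' _ _ []; lia.
apply/esym/fsbig_widen => [I [l lM <-]|I [/dyadicP[l [j [lM jN ->]]] nI]].
  apply/dyadicP; exists l, (i %/ 2 ^ l.+1)%N; split=> //.
  exact: divn_block_leaves.
by apply: T0; apply/eqP => ij; apply: nI; exists l => //; rewrite ij.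
Qed.

Lemma sqrt_dlen M l j : let L := dlen R (code M l j) in
  (Num.sqrt L)^-1 * L * (Num.sqrt L)^-1 = 1.
Proof.
move=> L; have L0 : 0 < L by exact: dlen_gt0.
have s0 : Num.sqrt L != 0 by rewrite gt_eqF// sqrtr_gt0.
by rewrite -{2}(sqr_sqrtr (ltW L0)); field.
Qed.

Lemma pi_hl_mid M (f g : R -> C) i : cellwise M f -> cellwise M g ->
  (i < leaves M)%N -> pi_hl M f g (mid M i) =
    hl (fun i => f (mid M i)) (fun i => g (mid M i)) (M + M).+1 i.
Proof.
move=> cf cg iN; rewrite /pi_hl (sum_dyadic_mid iN); last first.
  by move=> l j /negbTE ij; rewrite phi_mid ij mul0r !mulr0.
apply: eq_bigr => l _; have jN := divn_block_leaves iN (ltn_ord l).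
rewrite wavelet_code// avg_code// phi_mid eqxx mul1r.
set s := (Num.sqrt _)^-1; have e : s * dlen R (code M l (i %/ 2 ^ l.+1)) * s = 1.
  exact: sqrt_dlen.
rewrite -[RHS]mul1r -(rmorph1 (@real_complex R)) -e !rmorphM.
by ring.
Qed.

Lemma pi_lh_mid M (f g : R -> C) i : cellwise M f -> cellwise M g ->
  (i < leaves M)%N -> pi_lh M f g (mid M i) =
    hl (fun i => g (mid M i)) (fun i => f (mid M i)) (M + M).+1 i.
Proof.
move=> cf cg iN; rewrite -pi_hl_mid// /pi_lh /pi_hl.
by apply: eq_fsbigr => I _; rewrite (mulrC (avg f I)).
Qed.

Lemma pi_hh_mid M (f g : R -> C) i : cellwise M f -> cellwise M g ->
  (i < leaves M)%N -> pi_hh M f g (mid M i) =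
    hh (fun i => f (mid M i)) (fun i => g (mid M i)) (M + M).+1 i.
Proof.
move=> cf cg iN; rewrite /pi_hh (sum_dyadic_mid iN); last first.
  move=> l j /negbTE ij.
  by rewrite dset_code (indic_itv_cell _ _ _ (mid_bounds M i)) ij mul0r mulr0.
apply: eq_bigr => l _; have jN := divn_block_leaves iN (ltn_ord l).
rewrite !wavelet_code// dset_code (indic_itv_cell _ _ _ (mid_bounds M i)) eqxx.
set L := dlen R _; set s := (Num.sqrt _)^-1; have e : s * L * s = 1 by exact: sqrt_dlen.
have L0 : L != 0 by rewrite gt_eqF// dlen_gt0.
have LC : L%:C%C != 0 by rewrite fmorph_eq0.
have eC : s%:C%C * L%:C%C * s%:C%C = 1 by rewrite -!rmorphM e.
by rewrite mulr1n !rmorphM -[RHS]mul1r -[in RHS]eC; field.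
Qed.

Lemma cellwise_pi_hl M (f g : R -> C) : cellwise M (pi_hl M f g).
Proof. by apply: cellwise_fsum => I DI; apply: cellwiseZ; exact: cellwise_phi. Qed.

Lemma cellwise_pi_lh M (f g : R -> C) : cellwise M (pi_lh M f g).
Proof. by apply: cellwise_fsum => I DI; apply: cellwiseZ; exact: cellwise_phi. Qed.

Lemma cellwise_pi_hh M (f g : R -> C) : cellwise M (pi_hh M f g).
Proof.
apply: cellwise_fsum => I DI; apply: cellwiseZ.
apply: (cellwise_comp (h := fun z => z / (dlen R I)%:C%C) (mul0r _)).
exact: cellwise_dset.
Qed.

End DyadicCodes.
(** * From level sets to the weak quasi-norm *)

Section WeakNormBound.
Context {R : realType}.
Local Notation C := R[i]%C.
Local Notation nc := (@Normc.normc R).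

(* The choice A = alpha t^(1/p), B = beta t^(1/q) with t = (l / (alpha beta))^r
   makes both terms equal to 1/t; alpha and beta are then let tend to the
   p-th root of a and the q-th root of b, which may vanish. *)
Lemma weak_bound_optimize (p q r K m a b l : R) :
  0 < p -> 0 < q -> p^-1 + q^-1 = r^-1 -> 0 < K -> 0 <= m -> 0 <= a -> 0 <= b ->
  0 < l ->
  (forall A B, 0 < A -> 0 < B -> A * B = l ->
     m <= K * (A `^ (- p) * a + B `^ (- q) * b)) ->
  l * m `^ r^-1 <= (2 * K) `^ r^-1 * (a `^ p^-1 * b `^ q^-1).
Proof.
move=> p0 q0 pqr K0 m0 a0 b0 l0 H.
have ri0 : 0 < r^-1 by rewrite -pqr addr_gt0// invr_gt0.
have r0 : 0 < r by rewrite -invr_gt0.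
have key (x y : R) : 0 < x -> 0 < y -> a <= x `^ p -> b <= y `^ q ->
    l * m `^ r^-1 <= (2 * K) `^ r^-1 * (x * y).
  move=> x0 y0 ax by_; have xy0 : 0 < x * y by rewrite mulr_gt0.
  pose t := (l / (x * y)) `^ r.
  have lxy0 : 0 < l / (x * y) by rewrite divr_gt0.
  have t0 : 0 < t by rewrite powR_gt0.
  have AB : (x * t `^ p^-1) * (y * t `^ q^-1) = l.
    rewrite mulrACA -powRD ?(gt_eqF t0) ?implybT// pqr /t -powRrM mulfV ?gt_eqF//.
    by rewrite powRr1 ?(ltW lxy0)// mulrCA mulfV ?mulr1// gt_eqF.
  have bound (s c z : R) : 0 < s -> 0 < z -> c <= z `^ s ->
      (z * t `^ s^-1) `^ (- s) * c <= t^-1.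
    move=> s0 z0 cz; rewrite powRM ?(ltW z0) ?powR_ge0// -powRrM mulrN mulVf ?gt_eqF//.
    rewrite powR_inv1 ?(ltW t0)// mulrAC ler_piMl ?invr_ge0 ?(ltW t0)//.
    by rewrite powRN mulrC ler_pdivrMr ?powR_gt0// mul1r.
  have m_le : m <= 2 * K * t^-1.
    apply: le_trans (H _ _ _ _ AB) _; rewrite ?mulr_gt0 ?powR_gt0//.
    have := bound p a x p0 x0 ax; have := bound q b y q0 y0 by_ => h1 h2.
    apply: le_trans (ler_wpM2l (ltW K0) (lerD h2 h1)) _.
    by rewrite le_eqVlt; apply/orP; left; apply/eqP; ring.
  have tE : (t^-1) `^ r^-1 = x * y / l.
    rewrite -powR_inv1 ?(ltW t0)// -powRrM mulN1r powRN /t -powRrM mulfV ?gt_eqF//.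
    by rewrite powRr1 ?(ltW lxy0)// invf_div.
  have : m `^ r^-1 <= (2 * K) `^ r^-1 * (x * y / l).
    rewrite -tE -powRM ?mulr_ge0 ?(ltW K0) ?invr_ge0 ?(ltW t0)//.
    apply: ge0_ler_powR; rewrite ?nnegrE ?(ltW ri0)//.
    by rewrite !mulr_ge0 ?(ltW K0)// invr_ge0 ltW.
  have ln0 : l != 0 by rewrite gt_eqF.
  move=> /(ler_wpM2l (ltW l0)) /le_trans; apply.
  by rewrite le_eqVlt; apply/orP; left; apply/eqP; field.
set c := (2 * K) `^ r^-1; set x := a `^ p^-1; set y := b `^ q^-1.
have c0 : 0 <= c by exact: powR_ge0.
have x0 : 0 <= x by exact: powR_ge0.
have y0 : 0 <= y by exact: powR_ge0.
apply/ler_addgt0Pr => e e0.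
(* With d <= 1, replacing [x * y] by [(x + d) * (y + d)] costs at most c d (x + y + 1) <= e; the
   final [+ 1] keeps the denominator positive. *)
pose d := Num.min 1 (e / (c * (x + y + 1) + 1)).
have D0 : 0 < c * (x + y + 1) + 1.
  by rewrite ltr_wpDl// mulr_ge0// !addr_ge0.
have d0 : 0 < d by rewrite /d lt_min ltr01 divr_gt0.
have d1 : d <= 1 by rewrite /d ge_min lexx.
have de : d * (c * (x + y + 1) + 1) <= e.
  by rewrite -ler_pdivlMr// /d ge_min lexx orbT.
have root (s z : R) : 0 < s -> 0 <= z -> z <= (z `^ s^-1 + d) `^ s.
  move=> s0 z0; apply: (@le_trans _ _ ((z `^ s^-1) `^ s)).
    by rewrite -powRrM mulVf ?gt_eqF// powRr1.
  apply: ge0_ler_powR; rewrite ?nnegrE ?(ltW s0) ?powR_ge0 ?addr_ge0 ?powR_ge0 ?(ltW d0)//.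
  by rewrite lerDl ltW.
have := key (x + d) (y + d) (ltr_wpDl x0 d0) (ltr_wpDl y0 d0) (root _ _ p0 a0) (root _ _ q0 b0).
move=> /le_trans; apply.
have : c * (d * d) <= c * d by rewrite ler_wpM2l// ler_piMl// ltW.
by move: de; rewrite -/c; lra.
Qed.

Lemma sum_leaves_av M (X : nat -> R) :
  mesh M * \sum_(0 <= i < leaves M) X i = 2 ^+ M * av X (M + M).+1 0.
Proof.
rewrite /av mul0n mul1n -/(leaves M) -leaves_mesh /leaves natrX.
have : (2 : R) ^+ (M + M).+1 != 0 by rewrite expf_neq0// pnatr_eq0.
by move=> ?; field.
Qed.

Lemma Lp_norm_cellwise (p : R) M (f : R -> C) : 0 < p -> cellwise M f ->
  Lp_norm p f =
    ((2 ^+ M * av (fun i => nc (f (mid M i)) `^ p) (M + M).+1 0) `^ p^-1)%:E.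
Proof.
move=> p0 cf; rewrite /Lp_norm unlock.
have h0 : nc 0 `^ p = 0 by rewrite Normc.normc0 powR0// gt_eqF.
have [_ e] := cellwise_integrates (cellwise_comp (h := fun z => nc z `^ p) h0 cf).
rewrite -poweR_EFin -sum_leaves_av -e; congr (_ `^ _)%E.
by apply: eq_integral => x _; rewrite /= ger0_norm ?normc_ge0.
Qed.

(** Transfer from the tree to the line, common to the three paraproducts. The length 2^M of the root
    multiplies the measure and both integrals alike, so the constant is independent of [M]. *)
Lemma weak_norm_bound (p q r : R)
    (T : (nat -> C) -> (nat -> C) -> nat -> nat -> C)
    (Pi : nat -> (R -> C) -> (R -> C) -> R -> C) :
  1 < p -> 1 < q -> p^-1 + q^-1 = r^-1 -> weak_type p q T ->
  (forall c d F G m i, T (fun k => c * F k) (fun k => d * G k) m i =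
     c * d * T F G m i) ->
  (forall M f g, cellwise M (Pi M f g)) ->
  (forall M f g i, cellwise M f -> cellwise M g -> (i < leaves M)%N ->
     Pi M f g (mid M i) =
       T (fun i => f (mid M i)) (fun i => g (mid M i)) (M + M).+1 i) ->
  exists2 K : R, 0 < K & forall M f g, haar_span M f -> haar_span M g ->
    (weak_norm r (Pi M f g) <= K%:E * (Lp_norm p f * Lp_norm q g))%E.
Proof.
move=> p1 q1 pqr wT TZ cP PT.
have p0 : 0 < p by lra.
have q0 : 0 < q by lra.
have [K K0 H] := weak_type_scaled wT TZ.
exists ((2 * K) `^ r^-1); first by rewrite powR_gt0// mulr_gt0.
move=> M f g /cellwise_haar_span cf /cellwise_haar_span cg.
rewrite (Lp_norm_cellwise p0 cf) (Lp_norm_cellwise q0 cg) -!EFinM.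
apply: ge_ereal_sup => _ /= [l l0 <-].
set A := [set x | _].
(* The level set is cellwise because [l > 0] makes the indicator vanish where the paraproduct
   does. *)
have Ah : (\1_A : R -> R) = (fun z => (l <= nc z)%R%:R) \o Pi M f g.
  by apply/funext => x /=; rewrite indicE mem_setE.
have cA : cellwise M (\1_A : R -> R).
  rewrite Ah; apply: cellwise_comp (cP M f g).
  by rewrite Normc.normc0 leNgt l0.
rewrite (cellwise_measure cA) sum_leaves_av poweR_EFin -EFinM lee_fin.
have M0 : 0 <= 2 ^+ M :> R by rewrite exprn_ge0.
apply: weak_bound_optimize => //.
- by rewrite mulr_ge0// av_ge0.
- by rewrite mulr_ge0// av_ge0// => i; exact: powR_ge0.
- by rewrite mulr_ge0// av_ge0// => i; exact: powR_ge0.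
move=> a b a0 b0 abl.
have := ler_wpM2l M0 (H (fun i => f (mid M i)) (fun i => g (mid M i))
  (M + M).+1 0%N a b a0 b0).
rewrite abl => h; apply: le_trans (le_trans _ h) _.
  rewrite ler_wpM2l//; apply: ler_av => i; rewrite mul0n mul1n /= => iN.
  by rewrite Ah /= PT.
by rewrite le_eqVlt; apply/orP; left; apply/eqP; ring.
Qed.

End WeakNormBound.

(** * The three paraproduct estimates with a common constant *)

Theorem proposition5p5 (R : realType) (p q r : R) (hp : 1 < p) (hq : 1 < q)
    (hr : p^-1 + q^-1 = r^-1) :
  exists2 C : R, 0 < C &
    forall (M : nat) (f g : R -> R[i]%C), (0 < M)%N -> haar_span M f -> haar_span M g ->
    [/\ (weak_norm r (pi_hl M f g) <= C%:E * (Lp_norm p f * Lp_norm q g))%E,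
        (weak_norm r (pi_lh M f g) <= C%:E * (Lp_norm p f * Lp_norm q g))%E
      & (weak_norm r (pi_hh M f g) <= C%:E * (Lp_norm p f * Lp_norm q g))%E].
Proof.
have [C1 C10 H1] := weak_norm_bound hp hq hr (hl_weak_type hp hq)
  (@hlZ _) (@cellwise_pi_hl R) (@pi_hl_mid R).
have [C2 C20 H2] := weak_norm_bound hp hq hr (lh_weak_type hp hq)
  (fun c d F G m i => etrans (hlZ d c G F m i) (congr1 (fun z => z * _) (mulrC d c)))
  (@cellwise_pi_lh R) (@pi_lh_mid R).
have [C3 C30 H3] := weak_norm_bound hp hq hr (hh_weak_type hp hq)
  (@hhZ _) (@cellwise_pi_hh R) (@pi_hh_mid R).
exists (C1 + C2 + C3); first by rewrite !addr_gt0.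
move=> M f g _ Sf Sg.
have N0 : (0 <= Lp_norm p f * Lp_norm q g)%E.
  by rewrite mule_ge0// /Lp_norm Lnorm_ge0.
have enlarge (c : R) : c <= C1 + C2 + C3 ->
    (c%:E * (Lp_norm p f * Lp_norm q g) <=
     (C1 + C2 + C3)%:E * (Lp_norm p f * Lp_norm q g))%E.
  by move=> cC; rewrite lee_wpmul2r// lee_fin.
split.
- by apply: le_trans (H1 M f g Sf Sg) (enlarge _ _); lra.
- by apply: le_trans (H2 M f g Sf Sg) (enlarge _ _); lra.
- by apply: le_trans (H3 M f g Sf Sg) (enlarge _ _); lra.
Qed.
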